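(* Let $(\sigma_i^2,s_i^2)$, $i=1,\dots,N$, follow the hierarchical model in which $\sigma_i^2\overset{iid}{\sim} g$ (an arbitrary prior on $(0,\infty)$) and, conditionally on the variances, the $s_i^2$ are independent with $s_i^2\mid\sigma_i^2\sim \sigma_i^2\chi_k^2/k$. Let $f$ be the marginal probability density function of $s_i^2$. Consider Stein's loss function $$L_2\left(\sigma^2_{[1:N]},\hat\sigma^2_{[1:N]}\right)=\sum_{i=1}^N\left(\frac{\hat\sigma_i^2}{\sigma_i^2}-\ln\frac{\hat\sigma_i^2}{\sigma_i^2}-1\right).$$ Then the Bayes rule $(\hat\sigma_{1,Stein}^{2},\dots,\hat\sigma_{N,Stein}^{2})$ under $L_2$ is given by $$\hat\sigma_{i,Stein}^{2}=\left(\frac{k-2}{k s_i^2}-\frac{2}{k}\cdot\frac{f'(s_i^2)}{f(s_i^2)}\right)^{-1},\qquad i=1,\dots,N.$$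
   Context: $k$ is the (known) degrees of freedom, $\chi_k^2$ denotes a chi-square random variable with $k$ degrees of freedom, and $p(s^2\mid\sigma^2)$ denotes the density of $s^2$ given $\sigma^2$, i.e. of $\sigma^2\chi^2_k/k$. $g$ denotes the prior density of $\sigma_i^2$. The marginal density of the sample variances is $f(s^2)=\int_0^\infty p(s^2\mid\sigma^2)g(\sigma^2)\,d\sigma^2$ for $s^2>0$. The functions $f,f'$ are regarded as functions of the single positive variable $s^2$ (derivatives are taken with respect to $s^2$). Notation: $\sigma^2_{[1:N]}=(\sigma_1^2,\dots,\sigma_N^2)$, $\hat\sigma^2_{[1:N]}=(\hat\sigma_1^2,\dots,\hat\sigma_N^2)$, $s^2_{[1:N]}=(s_1^2,\dots,s_N^2)$. The Bayes rule for a loss $L$ is the function of the data $s^2_{[1:N]}$ minimizing the posterior expected loss $E[L(\sigma^2_{[1:N]},\hat\sigma^2_{[1:N]})\mid s^2_{[1:N]}]$ over positive $\hat\sigma_1^2,\dots,\hat\sigma_N^2$. *)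

(* Defs.v *)
From HB Require Import structures.
From mathcomp Require Import all_boot all_order all_algebra.
From mathcomp Require Import all_classical all_reals all_analysis.

Set Implicit Arguments.
Unset Strict Implicit.
Unset Printing Implicit Defensive.

Import Order.TTheory GRing.Theory Num.Theory.
Import numFieldNormedType.Exports.

Local Open Scope classical_set_scope.
Local Open Scope ring_scope.

Definition Gamma (R : realType) (z : R) : R :=
  \int[lebesgue_measure]_(t in `]0%R, +oo[) (t `^ (z - 1) * expR (- t)).

Definition chi2_pdf (R : realType) (k : nat) (x : R) : R :=
  if 0 < x then
    x `^ (k%:R / 2 - 1) * expR (- x / 2) / (2 `^ (k%:R / 2) * Gamma (k%:R / 2))
  else 0.

Definition chi2_law (R : realType) (k : nat) (B : set R) : \bar R :=
  (\int[lebesgue_measure]_(x in B) (chi2_pdf k x)%:E)%E.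

(* The law of v * X / k, where X is chi-square with k degrees of freedom. *)
Definition sampling_law (R : realType) (k : nat) (v : R) (B : set R) : \bar R :=
  chi2_law k [set x | B (v * x / k%:R)].

(* For v > 0, the density of [sampling_law k v] at s (change of variables
   s = v * x / k in [chi2_pdf]). *)
Definition sampling_pdf (R : realType) (k : nat) (s v : R) : R :=
  k%:R / v * chi2_pdf k (k%:R * s / v).

Definition marginal_pdf (R : realType) (k : nat) (g : R -> R) (s : R) : R :=
  \int[lebesgue_measure]_(v in `]0%R, +oo[) (sampling_pdf k s v * g v).

Definition prior_density (R : realType) (g : R -> R) : Prop :=
  [/\ measurable_fun (`]0, +oo[ : set R) g,
      (forall v, 0 < v -> 0 <= g v) &
      (\int[lebesgue_measure]_(v in `]0%R, +oo[) (g v)%:E = 1)%E].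

(* The first clause says that the coordinates of Sigma2 are iid with density g
   on (0, +oo).  The second one says that, conditionally on Sigma2, the
   coordinates of S2 are independent, the i-th one having the law of
   sigma_i^2 * chi2_k / k. *)
Definition hierarchical_model (R : realType) (N k : nat) (g : R -> R)
    (d : measure_display) (Omega : measurableType d) (P : probability Omega R)
    (Sigma2 S2 : {RV P >-> N.-tuple R}) : Prop :=
  (forall A : 'I_N -> set R, (forall i, measurable (A i)) ->
    P [set w | forall i, A i (tnth (Sigma2 w) i)] =
    (\prod_(i < N)
       \int[lebesgue_measure]_(v in A i `&` `]0%R, +oo[) (g v)%:E)%E) /\
  (forall (A : set (N.-tuple R)) (B : 'I_N -> set R),
    measurable A -> (forall i, measurable (B i)) ->
    P (Sigma2 @^-1` A `&` [set w | forall i, B i (tnth (S2 w) i)]) =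
    (\int[P]_(w in Sigma2 @^-1` A)
       \prod_(i < N) sampling_law k (tnth (Sigma2 w) i) (B i))%E).

(* Q is a regular conditional distribution of Theta given D. *)
Definition is_posterior (R : realType) (d dT dX : measure_display)
    (Omega : measurableType d) (T : measurableType dT) (X : measurableType dX)
    (P : probability Omega R) (Theta : {RV P >-> T}) (D : {RV P >-> X})
    (Q : R.-pker X ~> T) : Prop :=
  forall (A : set T) (B : set X), measurable A -> measurable B ->
    P (Theta @^-1` A `&` D @^-1` B) = (\int[P]_(w in D @^-1` B) Q (D w) A)%E.

Definition positive_tuple (R : realType) (N : nat) (a : N.-tuple R) : Prop :=
  forall i, 0 < tnth a i.

Definition stein_loss (R : realType) (N : nat) (sigma2 a : N.-tuple R) : R :=
  \sum_(i < N) (tnth a i / tnth sigma2 i - ln (tnth a i / tnth sigma2 i) - 1).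

Definition posterior_expected_loss (R : realType) (N : nat)
    (L : N.-tuple R -> N.-tuple R -> R)
    (Q : R.-pker N.-tuple R ~> N.-tuple R) (s a : N.-tuple R) : \bar R :=
  (\int[Q s]_sigma2 (L sigma2 a)%:E)%E.

(* Posteriors are only determined up to null sets of data, hence the
   "almost surely". *)
Definition bayes_rule (R : realType) (N : nat)
    (L : N.-tuple R -> N.-tuple R -> R)
    (d : measure_display) (Omega : measurableType d) (P : probability Omega R)
    (S2 : {RV P >-> N.-tuple R}) (Q : R.-pker N.-tuple R ~> N.-tuple R)
    (delta : N.-tuple R -> N.-tuple R) : Prop :=
  {ae P, forall w,
    positive_tuple (delta (S2 w)) /\
    forall a, positive_tuple a ->
      (posterior_expected_loss L Q (S2 w) (delta (S2 w)) <=
       posterior_expected_loss L Q (S2 w) a)%E}.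

(* Main.v *)
Require Import Defs.
From HB Require Import structures.
From mathcomp Require Import all_boot all_order all_algebra.
From mathcomp Require Import all_classical all_reals all_analysis.
From mathcomp Require Import measurable_realfun ring lra.

Set Implicit Arguments.
Unset Strict Implicit.
Unset Printing Implicit Defensive.

Import Order.TTheory GRing.Theory Num.Theory.
Import numFieldNormedType.Exports.

Local Open Scope classical_set_scope.
Local Open Scope ring_scope.

(** Stein's loss in one coordinate is [x / v - ln (x / v) - 1]. Its posterior
    expectation, as a function of the estimate [x], is [x * m - ln x] up to a
    constant, where [m] is the posterior mean of [v^-1]; it has the unique
    minimizer [x = m^-1]. The formula then says that [m] can be computed from
    the marginal density [f] of the data. Indeed, with [a = k / 2] the density
    of [s] given [v] is proportional to

      [s ^ (a - 1) * v ^ (- a) * exp (- a * s / v)],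

    and the derivative of its logarithm with respect to [s] is
    [(a - 1) / s - a / v]. Differentiating [f] under the integral sign shows
    that [f' / f] is the posterior mean of this quantity, that is
    [(a - 1) / s - a * m], which is solved for [m] ([score_identity]).

    Two points need care. The prior is arbitrary, so it must be shown that the
    expected loss is finite and that differentiation under the integral sign is
    licit; both hold because the kernels [v ^ (- r) * exp (- c / v)] with
    [0 < r] and [0 < c] are bounded ([invgamma_kernel_le]), and the product of
    such a kernel with [ln v] is dominated by a constant plus the kernel of
    order [r + 1] ([normr_ln_le]). The normalizing
    constant of the chi-square density cancels in the posterior; it has to be
    positive, and this follows from the existence of the model
    ([model_normalizer_gt0]).

    The posterior is only given as some regular conditional distribution [Q] of
    the variances given the data. As the loss is a sum over the coordinates,
    only the marginals of [Q] matter. They are identified almost surely with the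
    explicit posterior of a single variance ([posterior_marginals_ae]): the
    joint law of one variance and all the data is computed on rectangles by
    independence ([integral_prod_indep], [joint_rectangles]), extended to all
    events since rectangles determine a measure ([joint_law_posterior]), and the
    marginal is recovered from its values on countably many rays. *)

(** * Measures given by a density *)

(** The measure structure of a pushforward depends on a proof that the map is
    measurable; the notation makes that proof an explicit argument. *)
Local Notation image_measure :=
  measure_function_pushforward__canonical__measure_function_Measure.

(** Multiplication is not continuous at the point where an infinite [c] meets
    the limit [0]; there a sequence bounded by its limit is identically zero,
    which rescues the convergence. *)
Lemma cvge_ge0Ml (R : realType) (c l : \bar R) (u : (\bar R)^nat) :
  (0 <= c)%E -> (forall n, 0 <= u n <= l)%E -> u n @[n --> \oo] --> l ->
  (c * u n)%E @[n --> \oo] --> (c * l)%E.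
Proof.
move=> c0 ul ucvg; have [cfin|] := boolP (c \is a fin_num); first exact: cvgeZl.
rewrite ge0_fin_numE// -leNgt leye_eq => /eqP ->.
have l0 : (0 <= l)%E by have /andP[u0 ?] := ul 0%N; exact: le_trans u0 _.
move: l0; rewrite le_eqVlt => /predU1P[l0|l0].
  rewrite -l0 mule0; apply: cvg_near_cst; apply: nearW => n.
  by have := ul n; rewrite -l0 -eq_le => /eqP <-; rewrite mule0.
rewrite gt0_mulye//; apply: cvg_near_cst.
have : \forall n \near \oo, (0 < u n)%E.
  exact: (ucvg [set y | 0 < y]%E (open_ereal_gt' l0)).
by apply: filterS => n un0; rewrite gt0_mulye.
Qed.

Section density_measure.
Local Open Scope ereal_scope.
Context d (T : measurableType d) (R : realType).
Variables (mu : {measure set T -> \bar R}) (W : T -> \bar R).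

(** The proofs are arguments so that the measure structure can be inferred from
    the term. *)
Definition density_measure (mW : measurable_fun [set: T] W)
  (W0 : forall x, 0 <= W x) (A : set T) : \bar R := \int[mu]_(x in A) W x.

Hypotheses (mW : measurable_fun [set: T] W) (W0 : forall x, 0 <= W x).

Let density_measure0 : density_measure mW W0 set0 = 0.
Proof. by rewrite /density_measure integral_set0. Qed.

Let density_measure_ge0 A : 0 <= density_measure mW W0 A.
Proof. exact: integral_ge0. Qed.

Let density_measure_sigma_additive :
  semi_sigma_additive (density_measure mW W0).
Proof.
move=> F mF tF mUF; rewrite /density_measure; apply: cvg_toP.
  apply: ereal_nondecreasing_is_cvgn => m n mn.
  by apply: lee_sum_nneg_natr => // k _ _; exact: integral_ge0.
by rewrite ge0_integral_bigcup//; exact: measurable_funTS.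
Qed.

HB.instance Definition _ := isMeasure.Build _ _ _ (density_measure mW W0)
  density_measure0 density_measure_ge0 density_measure_sigma_additive.

Import HBNNSimple.

(** Both sides agree on indicators by definition, hence on simple functions by
    linearity, and on nonnegative functions by monotone convergence. *)
Lemma integral_density_measure D (h : T -> \bar R) :
  measurable D -> measurable_fun D h -> (forall x, D x -> 0 <= h x) ->
  \int[density_measure mW W0]_(x in D) h x = \int[mu]_(x in D) (W x * h x).
Proof.
move=> mD mh h0.
pose h_ := nnsfun_approx mD mh.
have cvgh x : D x -> (h_ n x)%:E @[n --> \oo] --> h x.
  by move=> Dx; exact: cvg_nnsfun_approx.
have ndh x : D x -> {homo (fun n => (h_ n x)%:E) : m n / (m <= n)%N >-> m <= n}.
  by move=> Dx m n mn; rewrite lee_fin; exact/lefP/nd_nnsfun_approx.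
have mWD : measurable_fun D W by exact: measurable_funTS.
transitivity (limn (fun n => \int[density_measure mW W0]_(x in D) (h_ n x)%:E)).
  rewrite -monotone_convergence//.
  - by apply: eq_integral => x /[!inE] Dx; apply/esym/cvg_lim => //;
      exact: cvgh.
  - by move=> n; exact/measurable_EFinP/measurable_funTS.
  - by move=> n x _; rewrite lee_fin.
transitivity (limn (fun n => \int[mu]_(x in D) (W x * (h_ n x)%:E)));
  last first.
  rewrite -monotone_convergence//.
  - apply: eq_integral => x /[!inE] Dx; apply/cvg_lim => //.
    apply: cvge_ge0Ml => //; last exact: cvgh.
    move=> n; rewrite lee_fin fun_ge0/=.
    by apply: cvge_to_ge (cvgh _ Dx) _; exists n => // m /=; exact: ndh.
  - move=> n; apply: emeasurable_funM => //.
    by apply/measurable_EFinP/measurable_funTS.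
  - by move=> n x Dx; rewrite mule_ge0// lee_fin.
  - by move=> x Dx m n mn; rewrite lee_wpmul2l//; exact: ndh.
congr (limn _); apply/funext => n.
transitivity (\sum_(k \in range (h_ n))
    \int[density_measure mW W0]_(x in D) (k * \1_(h_ n @^-1` [set k]) x)%:E).
  under eq_integral do rewrite fimfunE -fsumEFin//.
  rewrite ge0_integral_fsum//.
  - by move=> y; apply/measurable_EFinP/measurable_funM => //;
      exact: measurable_funTS.
  - by move=> y x _; rewrite nnfun_muleindic_ge0.
transitivity (\sum_(k \in range (h_ n))
    \int[mu]_(x in D) (W x * (k * \1_(h_ n @^-1` [set k]) x)%:E)); last first.
  rewrite -ge0_integral_fsum//.
  - apply: eq_integral => x _; rewrite -ge0_mule_fsumr.
      by rewrite fsumEFin// -fimfunE.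
    by move=> k; rewrite nnfun_muleindic_ge0.
  - move=> k; apply: emeasurable_funM => //.
    by apply/measurable_EFinP/measurable_funM => //; exact: measurable_funTS.
  - by move=> k x _; rewrite mule_ge0// nnfun_muleindic_ge0.
apply: eq_fsbigr => k _.
rewrite integralZl_indic_nnsfun// integral_indic//.
(* A nonnegative simple function has no negative value, so that only the
   nonnegative coefficients matter. *)
have [k0|k0] := ltP k 0%R.
  rewrite preimage_nnfun0// set0I measure0 mule0.
  by under eq_integral do rewrite indicE in_set0 mulr0 mule0; rewrite integral0.
under eq_integral do rewrite EFinM muleCA.
rewrite ge0_integralZl//; last 2 first.
- apply: emeasurable_funM => //.
  by apply/measurable_EFinP; exact: measurable_funTS.
- by move=> x _; rewrite mule_ge0// lee_fin.
congr (_ * _); rewrite /= /density_measure setIC.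
by rewrite integral_mkcondr epatch_indic.
Qed.

End density_measure.

(** * Independent coordinates *)

Section expectation_of_products.
Local Open Scope ereal_scope.
Context d (Omega : measurableType d) d' (T : measurableType d') (R : realType).
Variables (P : {measure set Omega -> \bar R}) (N : nat).
Variables (X : 'I_N -> Omega -> T) (mu : 'I_N -> {measure set T -> \bar R}).
Hypothesis mX : forall i, measurable_fun [set: Omega] (X i).

Lemma emeasurable_prod (I : Type) (s : seq I) (p : pred I)
    (h : I -> Omega -> \bar R) :
  (forall i, measurable_fun [set: Omega] (h i)) ->
  measurable_fun [set: Omega] (fun w => \prod_(i <- s | p i) h i w).
Proof.
move=> mh; elim: s => [|i s ih].
  by under eq_fun do rewrite big_nil; exact: measurable_cst.
under eq_fun do rewrite big_cons; case: (p i) => //.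
exact: emeasurable_funM.
Qed.

Lemma prod_indic (A : 'I_N -> set T) w :
  \prod_(i < N) (\1_(A i) (X i w))%:E =
  (\1_[set w | forall i, A i (X i w)] w)%:E :> \bar R.
Proof.
rewrite [in RHS]indicE; have [/[!inE] Aw|] := boolP (_ \in _).
  by rewrite big1// => i _; rewrite indicE mem_set.
rewrite notin_setE => /existsNP[i Ai].
by rewrite (bigD1 i)//= indicE memNset// mul0e.
Qed.

Hypothesis PX : forall A : 'I_N -> set T, (forall i, measurable (A i)) ->
  P [set w | forall i, A i (X i w)] = \prod_(i < N) mu i (A i).

Lemma measurable_forall_preimage (A : 'I_N -> set T) :
  (forall i, measurable (A i)) -> measurable [set w | forall i, A i (X i w)].
Proof.
move=> mA; have -> : [set w | forall i, A i (X i w)] =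
    \bigcap_(i in [set: 'I_N]) (X i @^-1` A i).
  by apply/seteqP; split => w /= Aw => [i _|i]; exact: Aw.
apply: fin_bigcap_measurable => // i _.
by rewrite -[X in measurable X]setTI; exact: mX.
Qed.

(** The hypothesis [PX] is the case where all the [h i] are indicators. General
    functions replace the indicators one coordinate at a time: once the other
    factors are fixed, both sides are integrals of [h i] against measures on
    [T], and these two measures agree by the induction hypothesis. *)
Lemma integral_prod_indep (h : 'I_N -> T -> \bar R) :
  (forall i, measurable_fun [set: T] (h i)) -> (forall i x, 0 <= h i x) ->
  \int[P]_w \prod_(i < N) h i (X i w) = \prod_(i < N) \int[mu i]_x h i x.
Proof.
move=> mh h0.
suff main m : (m <= N)%N -> forall h : 'I_N -> T -> \bar R,
    (forall i, measurable_fun [set: T] (h i)) -> (forall i x, 0 <= h i x) ->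
    (forall i : 'I_N, (m <= i)%N ->
       exists2 A, measurable A & h i = EFin \o \1_A) ->
    \int[P]_w \prod_(i < N) h i (X i w) = \prod_(i < N) \int[mu i]_x h i x.
  by apply: (main N) => // i; rewrite leqNgt ltn_ord.
elim: m => [_|m ih mN] {}h {}mh {}h0 hA.
  have /choice[A hA'] : forall i, exists A, measurable A /\ h i = EFin \o \1_A.
    by move=> i; have [A mA ->] := hA i isT; exists A.
  under eq_integral do under eq_bigr do rewrite (hA' _).2 /=.
  under eq_integral do rewrite prod_indic.
  have mA i := (hA' i).1.
  rewrite integral_indic//; last exact: measurable_forall_preimage.
  rewrite setIT PX//; apply: eq_bigr => i _.
  by rewrite (hA' i).2 integral_indic// setIT.
pose i0 := Ordinal mN.
pose W w := \prod_(i < N | i != i0) h i (X i w).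
pose c := \prod_(i < N | i != i0) \int[mu i]_x h i x.
have c0 : 0 <= c by apply: prode_ge0 => i _; exact: integral_ge0.
have W0 w : 0 <= W w by apply: prode_ge0.
have mhX i : measurable_fun [set: Omega] (fun w => h i (X i w)).
  exact: measurableT_comp.
have mW : measurable_fun [set: Omega] W by exact: emeasurable_prod.
have mc : measurable_fun [set: T] (cst c) by exact: measurable_cst.
rewrite [RHS](bigD1 i0)//= -/c muleC.
under eq_integral do rewrite (bigD1 i0)//= -/(W _) muleC.
rewrite -(integral_density_measure P mW W0)//.
rewrite -(ge0_integral_pushforward (mX i0) _ (D := setT))//.
transitivity (\int[density_measure (mu i0) mc (fun=> c0)]_x h i0 x); last first.
  by rewrite integral_density_measure//= ge0_integralZl.
(* With [h i0] replaced by the indicator of [A], the induction hypothesis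
   applies. *)
apply: eq_measure_integral => A mA _.
rewrite /pushforward /= /density_measure integral_cst//.
transitivity (\int[P]_w \prod_(i < N)
    (if i == i0 then EFin \o \1_A else h i) (X i w)).
  rewrite [LHS]integral_mkcond; apply: eq_integral => w _.
  rewrite (bigD1 i0)//= eqxx/= patchE indicE.
  have -> : (w \in X i0 @^-1` A) = (X i0 w \in A).
    by apply/idP/idP; rewrite !inE.
  case: ifP => _; last by rewrite mul0e.
  by rewrite mul1e; apply: eq_bigr => i /negbTE ->.
rewrite (ih (ltnW mN) (fun i => if i == i0 then EFin \o \1_A else h i));
  last 3 first.
- by move=> i; case: ifP => // _; apply/measurable_EFinP.
- by move=> i x; case: ifP => // _; rewrite /= lee_fin.
- move=> i mi; have [_|ii0] := eqVneq i i0; first by exists A.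
  apply: hA; rewrite ltn_neqAle mi andbT eq_sym.
  by apply: contra ii0 => /eqP im; apply/eqP/val_inj.
rewrite (bigD1 i0)//= eqxx integral_indic// setIT muleC; congr (_ * _).
by apply: eq_bigr => i /negbTE ->.
Qed.

End expectation_of_products.

(** * Sets that determine a finite measure *)

Section determining_classes.
Context (R : realType).

(** Rectangles are stable under intersection and generate the product
    sigma-algebra. *)
Lemma tuple_measure_unique d (T : measurableType d) N
    (m1 m2 : {measure set (N.-tuple T) -> \bar R}) :
  (m1 setT < +oo)%E ->
  (forall B : 'I_N -> set T, (forall i, measurable (B i)) ->
    m1 [set t | forall i, B i (tnth t i)] =
    m2 [set t | forall i, B i (tnth t i)]) ->
  forall E, measurable E -> m1 E = m2 E.
Proof.
move=> m1oo m12 E mE.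
pose G : set (set (N.-tuple T)) := [set E | exists2 B : 'I_N -> set T,
  (forall i, measurable (B i)) & E = [set t | forall i, B i (tnth t i)]].
have mG : G `<=` measurable.
  move=> _ [B mB ->].
  by apply: (measurable_forall_preimage (X := fun i t => tnth t i)) => // i;
    exact: measurable_tnth.
have GT : G setT by exists (fun=> setT) => //; apply/seteqP; split.
apply: (g_sigma_algebra_measure_unique G mG (fun=> setT)) => //.
- by apply/seteqP; split => // x _; exists 0%N.
- move=> _ _ [B mB ->] [C mC ->]; exists (fun i => B i `&` C i).
    by move=> i; exact: measurableI.
  apply/seteqP; split => t /= => [[Bt Ct] i|BCt]; first by split.
  by split => i; have [] := BCt i.
- by move=> _ [B mB ->]; exact: m12.
- apply: sub_sigma_algebra2 mE => A; rewrite -bigcup_seq/=.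
  move=> [i _ [B mB <-]]; exists (fun j => if j == i then B else setT).
    by move=> j; case: ifP.
  rewrite setTI; apply/seteqP; split => t /= Bt => [j|].
    by case: ifPn => // /eqP ->.
  by have := Bt i; rewrite eqxx.
Qed.

(** Indexing the rays by [nat] makes a statement that holds almost surely for
    each of them hold almost surely for all of them at once. *)
Definition rational_ray (n : nat) : set R :=
  if (unpickle n : option rat) is Some q then `]ratr q, +oo[ else setT.

Lemma measurable_rational_ray n : measurable (rational_ray n).
Proof. by rewrite /rational_ray; case: unpickle. Qed.

Lemma real_measure_unique (m1 m2 : {measure set R -> \bar R}) :
  (m1 setT < +oo)%E -> m1 setT = m2 setT ->
  (forall n, m1 (rational_ray n) = m2 (rational_ray n)) ->
  forall E, measurable E -> m1 E = m2 E.
Proof.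
move=> m1oo m12T m12 E mE.
pose G := [set: R] |` range rational_ray.
have mG : G `<=` measurable.
  by move=> _ [->//|[n _ <-]]; exact: measurable_rational_ray.
have ray (q : rat) : rational_ray (pickle q) = `]ratr q, +oo[%classic.
  by rewrite /rational_ray pickleK.
apply: (g_sigma_algebra_measure_unique G mG (fun=> setT)) => //.
- by move=> _; left.
- by apply/seteqP; split => // x _; exists 0%N.
- move=> _ _ [->|[m _ <-]] [->|[n _ <-]]; rewrite ?setTI ?setIT; try by left.
  + by right; exists n.
  + by right; exists m.
  + rewrite /rational_ray; case: (unpickle m : option rat) => [p|]; last first.
      by rewrite setTI; right; exists n.
    case: (unpickle n : option rat) => [q|]; last first.
      by rewrite setIT; right; exists (pickle p) => //; rewrite ray.
    right; exists (pickle (Num.max p q)) => //.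
    rewrite ray; apply/seteqP; split => x /=; rewrite !in_itv/= !andbT.
      move=> pqx; split; apply: le_lt_trans pqx; rewrite ler_rat le_max lexx//.
      by rewrite orbT.
    by move=> [px qx]; rewrite /Num.max; case: ifP.
- by move=> _ [->//|[n _ <-]]; exact: m12.
- have : (@RGenOInfty.G R).-sigma.-measurable E.
    by rewrite -RGenOInfty.measurableE.
  apply: smallest_sub; first exact: smallest_sigma_algebra.
  move=> _ [x ->].
  (* A ray with an arbitrary end point is the union of the rational rays that
     it contains. *)
  have -> : `]x, +oo[%classic = \bigcup_q
      (if x < ratr q then rational_ray (pickle q) else set0).
    apply/seteqP; split => y /=; rewrite in_itv/= ?andbT.
      move=> xy; have [q] := rat_in_itvoo xy; rewrite in_itv/= => /andP[xq qy].
      by exists q => //=; rewrite xq ray/= in_itv/= qy.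
    move=> [q _]/=; case: ifP => [xq|_ []]; rewrite ray/= in_itv/= andbT.
    exact: lt_trans.
  apply: (@bigcupT_measurable_rat _ (g_sigma_algebraType G)) => q.
  case: ifP => _; last exact: measurable0.
  by apply: sub_sigma_algebra; right; exists (pickle q).
Qed.

End determining_classes.

(** * Scaling the Lebesgue measure *)

Section scaling.
Local Open Scope ereal_scope.
Context (R : realType).
Local Notation lambda := (@lebesgue_measure R).

Lemma lebesgue_measure_scale (c : R) (A : set R) : (0 < c)%R -> measurable A ->
  lambda A = c%:E * lambda [set x | A (c * x)%R].
Proof.
move=> c0 mA.
have mc : measurable_fun [set: measurableTypeR R]
    ( *%R c : _ -> measurableTypeR R) by exact: measurable_funM.
pose m : {measure set (measurableTypeR R) -> \bar R} :=
  mscale (NngNum (ltW c0))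
    (image_measure lambda mc).
rewrite (lebesgue_measure_unique (mu := m) _ mA)// => _ [[a b]] _ <-.
rewrite /m/= /mscale/= /pushforward.
have -> : *%R c @^-1` (`]a, b]%classic : set R) =
    (`](a / c)%R, (b / c)%R]%classic : set R).
  apply/seteqP; split => x /=; rewrite !in_itv/=.
    by rewrite ltr_pdivrMr// ler_pdivlMr// mulrC.
  by rewrite ltr_pdivrMr// ler_pdivlMr// mulrC.
rewrite !lebesgue_measure_itv/= !lte_fin ltr_pM2r ?invr_gt0//.
case: ifP => _; last by rewrite mule0.
by rewrite -!EFinD -EFinM -mulrBl mulrC divfK// gt_eqF.
Qed.

(** The change of variables [s = c * x], for arbitrary measurable sets [B] and
    integrands. *)
Lemma integral_scale (c : R) (B : set R) (phi : R -> \bar R) : (0 < c)%R ->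
  measurable B -> measurable_fun [set: R] phi -> (forall x, 0 <= phi x) ->
  \int[lambda]_(x in [set x | B (c * x)%R]) phi x =
  \int[lambda]_(s in B) ((c^-1)%:E * phi (s / c)%R).
Proof.
move=> c0 mB mphi phi0.
have mc : measurable_fun [set: measurableTypeR R]
    ( *%R c : _ -> measurableTypeR R) by exact: measurable_funM.
have mphic : measurable_fun [set: R] (fun s : R => phi (s / c)%R).
  by apply: measurableT_comp => //; exact: measurable_funM.
pose m : {measure set (measurableTypeR R) -> \bar R} :=
  mscale (NngNum (ltW c0))
    (image_measure lambda mc).
rewrite [RHS](eq_measure_integral m); last first.
  by move=> A mA _; exact: (lebesgue_measure_scale c0 mA).
rewrite ge0_integralZl//; last 2 first.
- exact: measurable_funTS.
- by rewrite lee_fin invr_ge0 ltW.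
rewrite [in RHS]ge0_integral_mscale//; last exact: measurable_funTS.
rewrite muleA -EFinM mulVf ?gt_eqF// mul1e.
rewrite (ge0_integral_pushforward mc)//; last exact: measurable_funTS.
by apply: eq_integral => x _; rewrite /= mulrAC divff ?gt_eqF// mul1r.
Qed.

End scaling.

(** * The sampling density *)

(** Up to a constant, the inverse gamma density with shape [r - 1] and scale
    [c]. *)
Definition invgamma_kernel (R : realType) (r c v : R) : R :=
  v `^ (- r) * expR (- c / v).

Lemma powRV_sub1 (R : realType) (v r : R) : 0 < v ->
  v^-1 `^ (r - 1) = v * v `^ (- r).
Proof.
move=> v0; rewrite -(powR_inv1 (ltW v0)) -powRrM mulN1r opprB powRD.
  by rewrite powRr1// ltW.
by rewrite (gt_eqF v0) implybT.
Qed.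

Section sampling_density.
Context (R : realType) (k : nat).
Local Notation lambda := (@lebesgue_measure R).
Local Notation a := (k%:R / 2 : R).

Definition chi2_normalizer : R := 2 `^ a * Gamma a.

Lemma chi2_normalizer_ge0 : 0 <= chi2_normalizer.
Proof.
rewrite mulr_ge0 ?powR_ge0//; apply: Rintegral_ge0 => t _.
by rewrite mulr_ge0 ?powR_ge0 ?expR_ge0.
Qed.

Lemma chi2_pdf_ge0 (x : R) : 0 <= chi2_pdf k x.
Proof.
rewrite /chi2_pdf; case: ifP => // _.
by rewrite divr_ge0 ?chi2_normalizer_ge0// mulr_ge0 ?powR_ge0 ?expR_ge0.
Qed.

Lemma measurable_chi2_pdf : measurable_fun [set: R] (chi2_pdf k).
Proof.
apply: measurable_fun_ifT => //; first exact: measurable_fun_ltr.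
apply: measurable_funM => //; apply: measurable_funM => //.
apply: measurableT_comp => //; apply: measurable_funM => //.
Qed.

(** The sampling law integrates over [x] a function that is jointly measurable
    in [v] and [x]. *)
Lemma measurable_sampling_law (B : set R) : measurable B ->
  measurable_fun [set: R] (fun v => sampling_law k v B).
Proof.
move=> mB.
pose h (z : R * R) := (\1_B (z.1 * z.2 / k%:R) * chi2_pdf k z.2)%:E.
have mh : measurable_fun [set: R * R] h.
  apply/measurable_EFinP; apply: measurable_funM.
    apply: measurableT_comp => //; apply: measurable_funM => //.
    exact: measurable_funM.
  by apply: measurableT_comp => //; exact: measurable_chi2_pdf.
have h0 z : (0 <= h z)%E by rewrite lee_fin mulr_ge0// chi2_pdf_ge0.
have := measurable_fun_fubini_tonelli_F (m2 := lambda) h mh h0.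
congr (measurable_fun _ _); apply/funext => v.
rewrite /fubini_F /sampling_law /chi2_law [RHS]integral_mkcond.
apply: eq_integral => x _; rewrite /h/= patchE indicE.
have -> : (v * x / k%:R \in B) = (x \in [set x | B (v * x / k%:R)]).
  by apply/idP/idP; rewrite !inE.
by case: ifP => _; rewrite ?mul1r ?mul0r.
Qed.

Lemma sampling_law_ge0 (v : R) (B : set R) : (0 <= sampling_law k v B)%E.
Proof. by apply: integral_ge0 => x _; rewrite lee_fin chi2_pdf_ge0. Qed.

Hypothesis k_gt0 : (0 < k)%N.

Let kR_gt0 : 0 < k%:R :> R. Proof. by rewrite ltr0n. Qed.

(** The sampling density, extended by zero to nonpositive variances. *)
Definition likelihood (s v : R) : R :=
  if 0 < v then sampling_pdf k s v else 0.

Lemma likelihood_ge0 s v : 0 <= likelihood s v.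
Proof.
rewrite /likelihood; case: ifP => // v0.
by rewrite mulr_ge0 ?chi2_pdf_ge0// divr_ge0// ltW.
Qed.

Lemma sampling_law_density (v : R) (B : set R) : 0 < v -> measurable B ->
  sampling_law k v B = (\int[lambda]_(s in B) (likelihood s v)%:E)%E.
Proof.
move=> v0 mB; pose c := v / k%:R.
have c0 : 0 < c by rewrite divr_gt0.
have -> : sampling_law k v B =
    (\int[lambda]_(x in [set x | B (c * x)%R]) (chi2_pdf k x)%:E)%E.
  rewrite /sampling_law /chi2_law; congr integral.
  by apply/seteqP; split => x /=; rewrite /c mulrAC.
rewrite integral_scale//; last 2 first.
- by apply/measurable_EFinP; exact: measurable_chi2_pdf.
- by move=> x; rewrite lee_fin chi2_pdf_ge0.
apply: eq_integral => s _.
by rewrite -EFinM /likelihood v0 /sampling_pdf /c invf_div mulrA (mulrC s)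
  mulrAC.
Qed.

(** As a function of the variance, the likelihood is an inverse gamma kernel;
    the factor that depends on [s] alone will cancel in the posterior. *)
Lemma likelihoodE s v : 0 < s -> 0 < v ->
  likelihood s v =
  k%:R `^ a / chi2_normalizer * s `^ (a - 1) * invgamma_kernel a (a * s) v.
Proof.
move=> s0 v0.
have y0 : 0 < k%:R * s / v by rewrite divr_gt0// mulr_gt0.
rewrite /likelihood v0 /sampling_pdf /chi2_pdf y0 -/chi2_normalizer.
rewrite powRM ?mulr_ge0 ?ltW ?invr_gt0// powRM ?ltW//.
have -> : - (k%:R * s / v) / 2 = - (a * s) / v by ring.
rewrite powRV_sub1//.
have -> : k%:R `^ a = k%:R * k%:R `^ (a - 1) :> R.
  by rewrite mulr_powRB1 ?ltW// divr_gt0.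
rewrite /invgamma_kernel.
have v0' : v != 0 by rewrite gt_eqF.
move: (k%:R `^ (a - 1)) (s `^ _) (v `^ _) (expR _) (chi2_normalizer^-1).
move=> x1 x2 x3 x4 x5.
by field.
Qed.

Lemma likelihood_le0 s v : s <= 0 -> likelihood s v = 0.
Proof.
move=> s0; rewrite /likelihood; case: ifP => // v0.
rewrite /sampling_pdf /chi2_pdf ltNge mulr_le0_ge0 ?invr_ge0 ?(ltW v0)//=
  ?mulr0//.
by rewrite mulr_ge0_le0// ltW.
Qed.

Lemma measurable_likelihood :
  measurable_fun [set: R * R] (fun z => likelihood z.1 z.2).
Proof.
have -> : (fun z : R * R => likelihood z.1 z.2) = (fun z =>
    if 0 < z.2 then k%:R * z.2 `^ (-1) * chi2_pdf k (k%:R * z.1 * z.2 `^ (-1))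
    else 0).
  apply/funext => z; rewrite /likelihood; case: ifP => // z0.
  by rewrite /sampling_pdf powR_inv1// ltW.
have minv : measurable_fun [set: R * R] (fun z => z.2 `^ (-1)).
  exact: (measurableT_comp (measurable_powR _)).
apply: measurable_fun_ifT => //; first exact: measurable_fun_ltr.
apply: measurable_funM; first exact: measurable_funM.
apply: (measurableT_comp measurable_chi2_pdf).
by apply: measurable_funM => //; exact: measurable_funM.
Qed.

End sampling_density.

(** * The inverse gamma kernel *)

Section invgamma_kernel.
Context (R : realType).
Implicit Types r c v : R.

Lemma invgamma_kernel_ge0 r c v : 0 <= invgamma_kernel r c v.
Proof. by rewrite mulr_ge0 ?powR_ge0 ?expR_ge0. Qed.

Lemma invgamma_kernel_gt0 r c v : 0 < v -> 0 < invgamma_kernel r c v.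
Proof. by move=> v0; rewrite mulr_gt0 ?powR_gt0 ?expR_gt0. Qed.

Lemma invgamma_kernelS r c v : 0 < v ->
  invgamma_kernel (r + 1) c v = v^-1 * invgamma_kernel r c v.
Proof.
move=> v0; rewrite /invgamma_kernel mulrA; congr (_ * _).
rewrite -(powR_inv1 (ltW v0)) -powRD ?(gt_eqF v0) ?implybT//.
by congr (_ `^ _); ring.
Qed.

(** With [x = c / (r * v)], the bound is the inequality [x <= expR x] raised to
    the power [r]. *)
Lemma invgamma_kernel_le r c v : 0 < r -> 0 < c -> 0 < v ->
  invgamma_kernel r c v <= (r / c) `^ r.
Proof.
move=> r0 c0 v0; pose x := c / (r * v).
have x0 : 0 < x by rewrite divr_gt0// mulr_gt0.
have xr : x `^ r <= expR (c / v).
  have -> : c / v = x * r by rewrite /x; field; rewrite !gt_eqF.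
  rewrite expRM; apply: ge0_ler_powR; rewrite ?nnegrE ?expR_ge0 ?(ltW x0) ?(ltW
    r0)//.
  by apply: le_trans (expR_ge1Dx x); rewrite lerDr.
have -> : (r / c) `^ r = (v `^ (- r) * (r / c * v) `^ r).
  rewrite [in RHS]powRM ?ltW ?divr_gt0// mulrCA -powRD ?(gt_eqF v0) ?implybT//.
  by rewrite addNr powRr0 mulr1.
rewrite ler_wpM2l ?powR_ge0// mulNr expRN.
rewrite -[X in X `^ r](_ : x^-1 = _); last by rewrite /x; field;
  rewrite !gt_eqF.
rewrite -(powR_inv1 (ltW x0)) powRAC powR_inv1 ?powR_ge0//.
by rewrite lef_pV2// posrE ?expR_gt0 ?powR_gt0.
Qed.

Lemma invgamma_kernel_decr r c c' v : 0 < v -> c <= c' ->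
  invgamma_kernel r c' v <= invgamma_kernel r c v.
Proof.
move=> v0 cc'; rewrite ler_wpM2l ?powR_ge0//
  ler_expR ler_wpM2r ?invr_ge0 ?(ltW v0)//.
by rewrite lerN2.
Qed.

Lemma measurable_invgamma_kernel r c :
  measurable_fun (`]0, +oo[ : set R) (invgamma_kernel r c).
Proof.
apply: (eq_measurable_fun (fun v => v `^ (- r) * expR (- c * v `^ (-1)))).
  move=> v; rewrite inE/= in_itv/= andbT => v0.
  by rewrite /invgamma_kernel powR_inv1 ?ltW.
apply: measurable_funTS; apply: measurable_funM => //.
by apply: measurableT_comp => //; exact: measurable_funM.
Qed.

Lemma is_derive_invgamma_kernel r c v : 0 < v ->
  is_derive c 1 (fun c => invgamma_kernel r c v)
    (- invgamma_kernel (r + 1) c v).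
Proof.
move=> v0; rewrite invgamma_kernelS// /invgamma_kernel.
apply: is_derive_eq.
rewrite /GRing.scale/=. ring.
Qed.

(** Logarithms grow slower than any power at infinity and at zero; with the
    boundedness of the kernels, this makes the logarithm integrable under the
    posterior, whatever the prior is. *)
Lemma normr_ln_le r v : 0 < r -> 0 < v -> `|ln v| <= r^-1 * v `^ r + v^-1.
Proof.
move=> r0 v0.
have lnle (x : R) : 0 < x -> ln x <= x by move=> /ln_sublinear/ltW.
rewrite ler_norml; apply/andP; split.
  rewrite lerNl -lnV ?posrE//.
  by apply: le_trans (lnle _ _) _; rewrite ?invr_gt0//
    lerDr mulr_ge0 ?powR_ge0 ?invr_ge0 ?ltW.
apply: (@le_trans _ _ (r^-1 * v `^ r)); last by rewrite lerDl invr_ge0 ltW.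
by rewrite ler_pdivlMl// -ln_powR lnle// powR_gt0.
Qed.

End invgamma_kernel.

(** * Moments of a prior against the kernels *)

Section moments.
Context (R : realType) (gamma : probability R R).
Local Notation D := (`]0, +oo[%classic : set R).
Hypothesis gammaD : (gamma D = 1)%E.

(** The Laplace transform, in the scale parameter [c], of the law of [v^-1]
    reweighted by [v^-r]. *)
Definition moment (r c : R) : R := \int[gamma]_(v in D) invgamma_kernel r c v.

Lemma integrable_invgamma_kernel r c : 0 < r -> 0 < c ->
  gamma.-integrable D (EFin \o invgamma_kernel r c).
Proof.
move=> r0 c0.
apply: (@le_integrable _ _ _ _ _ _ _ (EFin \o cst ((r / c) `^ r))) => //.
- apply/measurable_EFinP. exact: measurable_invgamma_kernel.
- move=> v /=; rewrite in_itv/= andbT => v0.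
  rewrite lee_fin !ger0_norm ?powR_ge0 ?invgamma_kernel_ge0//.
  exact: invgamma_kernel_le.
- exact: (finite_measure_integrable_cst gamma).
Qed.

Lemma integrable_ln_invgamma_kernel r c : 0 < r -> 0 < c ->
  gamma.-integrable D (EFin \o (fun v => ln v * invgamma_kernel r c v)).
Proof.
move=> r0 c0.
apply: (@le_integrable _ _ _ _ _ _ _
    ((EFin \o cst (r^-1)%R) \+ (EFin \o invgamma_kernel (r + 1) c))%E) => //.
- apply/measurable_EFinP; apply: measurable_funM.
    by apply: measurable_funTS; exact: measurable_ln.
  exact: measurable_invgamma_kernel.
- move=> v /=; rewrite in_itv/= andbT => v0.
  have w0 q := invgamma_kernel_ge0 q c v.
  rewrite lee_fin [leRHS]ger0_norm ?addr_ge0 ?invr_ge0 ?(ltW r0)//.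
  rewrite normrM (ger0_norm (w0 _)).
  apply: (le_trans (ler_wpM2r (w0 r) (normr_ln_le r0 v0))).
  rewrite mulrDl -invgamma_kernelS// lerD2r -mulrA ger_pMr ?invr_gt0//.
  rewrite /invgamma_kernel mulrA -powRD ?(gt_eqF v0) ?implybT//
    subrr powRr0 mul1r.
  by rewrite expR_le1 mulNr oppr_le0 divr_ge0 ?ltW.
- apply: integrableD => //; first exact: (finite_measure_integrable_cst gamma).
  by apply: integrable_invgamma_kernel => //; rewrite addr_gt0.
Qed.

Lemma moment_gt0 r c : 0 < r -> 0 < c -> 0 < moment r c.
Proof.
move=> r0 c0; have wi := integrable_invgamma_kernel r0 c0.
have m0 : 0 <= moment r c.
  by apply: Rintegral_ge0 => v _; exact: invgamma_kernel_ge0.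
rewrite lt_neqAle m0 andbT; apply/eqP => /esym m_eq0.
have : (\int[gamma]_(v in D) `|(invgamma_kernel r c v)%:E| = 0)%E.
  under eq_integral do rewrite gee0_abs ?lee_fin ?invgamma_kernel_ge0//.
  by rewrite -[LHS]fineK ?integrable_fin_num//
    -/(Rintegral _ _ _) -/(moment r c) m_eq0.
move/(ae_eq_integral_abs gamma (measurable_itv _) (measurable_int _ wi)) =>
  w_ae0.
have : gamma.-negligible D.
  apply: negligibleS w_ae0 => v /= Dv /(_ Dv)[]/eqP.
  by move: Dv; rewrite in_itv/= andbT => v0;
    rewrite gt_eqF// invgamma_kernel_gt0.
move=> /(@negligibleP _ _ _ gamma _ (measurable_itv _)) gD0.
have : (1 = 0 :> \bar R)%E by rewrite -gammaD.
by case=> /eqP; rewrite oner_eq0.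
Qed.

(** Differentiation under the integral sign: near [c], the derivative of the
    kernel is dominated by the kernel of order [r + 1] at [c / 2]. *)
Lemma is_derive_moment (r c : R) : 0 < r -> 0 < c ->
  is_derive c 1 (moment r) (- moment (r + 1) c).
Proof.
move=> r0 c0; have r10 : 0 < r + 1 by rewrite addr_gt0.
have c20 : 0 < c / 2 by rewrite divr_gt0.
have Ic : `](c / 2), (c * 2)[%classic c by rewrite /= in_itv/=; apply/andP;
  split; lra.
have I0 x : `](c / 2), (c * 2)[%classic x -> 0 < x.
  by rewrite /= in_itv/= => /andP[+ _]; exact: lt_trans.
have intw x : `](c / 2), (c * 2)[%classic x ->
    gamma.-integrable D (EFin \o invgamma_kernel r x).
  by move=> /I0 x0; exact: integrable_invgamma_kernel.
have dw x v : `](c / 2), (c * 2)[%classic x -> D v ->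
    derivable (fun c => invgamma_kernel r c v) x 1.
  move=> _; rewrite /= in_itv/= andbT => v0.
  by have [] := is_derive_invgamma_kernel r x v0.
have d1w x v : D v ->
    partial1of2 (invgamma_kernel r) x v = - invgamma_kernel (r + 1) x v.
  rewrite /= in_itv/= andbT => v0; rewrite partial1of2E.
  by have [] := is_derive_invgamma_kernel r x v0.
have G0 v := invgamma_kernel_ge0 (r + 1) (c / 2) v.
have intG := integrable_invgamma_kernel r10 c20.
have wG x v : `](c / 2), (c * 2)[%classic x -> D v ->
    `|partial1of2 (invgamma_kernel r) x v| <= invgamma_kernel (r + 1) (c / 2) v.
  move=> Ix Dv; rewrite d1w// normrN ger0_norm ?invgamma_kernel_ge0//.
  move: Dv; rewrite /= in_itv/= andbT => v0; apply: invgamma_kernel_decr => //.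
  by move: Ix; rewrite /= in_itv/= => /andP[/ltW].
apply: DeriveDef.
  exact: (derivable_under_integral (measurable_itv _) Ic intw dw G0 intG wG).
rewrite -derive1E.
rewrite (differentiation_under_integral (measurable_itv _) Ic intw dw G0 intG
  wG).
rewrite /moment -mulN1r -RintegralZl//; last exact: integrable_invgamma_kernel.
by apply: eq_Rintegral => v; rewrite inE => Dv; rewrite d1w// mulN1r.
Qed.

End moments.

(** * The evidence and its logarithmic derivative *)

Section evidence.
Context (R : realType) (k : nat) (gamma : probability R R).
Local Notation D := (`]0, +oo[%classic : set R).
Local Notation a := (k%:R / 2 : R).
Hypothesis k_gt0 : (0 < k)%N.
Hypothesis normalizer_gt0 : 0 < chi2_normalizer R k.
Hypothesis gammaD : (gamma D = 1)%E.

Let a_gt0 : 0 < a. Proof. by rewrite divr_gt0// ltr0n. Qed.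

Definition evidence (s : R) : R := \int[gamma]_(v in D) likelihood k s v.

Lemma integrable_likelihood s : 0 < s ->
  gamma.-integrable D (EFin \o likelihood k s).
Proof.
move=> s0; pose K := k%:R `^ a / chi2_normalizer R k * s `^ (a - 1).
apply: (@eq_integrable _ _ _ _ _ _ (fun v =>
  K%:E * (EFin \o invgamma_kernel a (a * s)) v)%E) => //.
  move=> v; rewrite inE/= in_itv/= andbT => v0.
  by rewrite -EFinM likelihoodE.
by apply: integrableZl => //; apply: integrable_invgamma_kernel => //;
  rewrite mulr_gt0.
Qed.

Lemma evidenceE s : 0 < s ->
  evidence s =
  k%:R `^ a / chi2_normalizer R k * s `^ (a - 1) * moment gamma a (a * s).
Proof.
move=> s0; rewrite /moment -RintegralZl//; last first.
  by apply: integrable_invgamma_kernel => //; rewrite mulr_gt0.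
apply: eq_Rintegral => v; rewrite inE/= in_itv/= andbT => v0.
by rewrite likelihoodE.
Qed.

Lemma evidence_gt0 s : 0 < s -> 0 < evidence s.
Proof.
move=> s0; rewrite evidenceE// mulr_gt0//; last first.
  by apply: moment_gt0 => //; rewrite mulr_gt0.
by rewrite mulr_gt0 ?divr_gt0 ?powR_gt0// ltr0n.
Qed.

Lemma evidence_logderivative (s : R) : 0 < s ->
  derive1 evidence s / evidence s =
  (a - 1) / s - a * (moment gamma (a + 1) (a * s) / moment gamma a (a * s)).
Proof.
move=> s0; have as0 : 0 < a * s by rewrite mulr_gt0.
pose K := k%:R `^ a / chi2_normalizer R k.
have K0 : K != 0 by rewrite gt_eqF// divr_gt0 ?powR_gt0// ltr0n.
have dp := is_derive1_powR (a - 1) s0.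
have dm : is_derive s 1 (fun s => moment gamma a (a * s))
    (- moment gamma (a + 1) (a * s) * a).
  have dm' := is_derive_moment gamma a_gt0 as0.
  have dl : is_derive s 1 ( *%R a : R -> R) a.
    by apply: is_derive_eq; rewrite /GRing.scale/= mulr1.
  exact: (is_derive1_comp dm' dl).
have de : is_derive s 1 evidence
    (K * ((a - 1) * s `^ (a - 1 - 1)) * moment gamma a (a * s) +
     K * s `^ (a - 1) * (- moment gamma (a + 1) (a * s) * a)).
  apply: (@near_eq_is_derive _ _ _
      (fun s => K * s `^ (a - 1) * moment gamma a (a * s))).
    near=> t; rewrite evidenceE//; near: t; exact: lt_nbhsr.
  apply: is_derive_eq.
  rewrite /GRing.scale/=; ring.
rewrite derive1E; have [_ ->] := de.
rewrite evidenceE// -/K.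
have m0 : moment gamma a (a * s) != 0 by rewrite gt_eqF// moment_gt0.
have p0 : s `^ (a - 1 - 1) != 0 by rewrite gt_eqF// powR_gt0.
have pS : s `^ 1 * s `^ (a - 1 - 1) = s `^ (a - 1).
  by rewrite -powRD ?(gt_eqF s0) ?implybT//; congr (_ `^ _); ring.
rewrite (powRr1 (ltW s0)) in pS; rewrite -pS.
by field; rewrite K0 m0 p0 gt_eqF.
Unshelve. all: by end_near. Qed.

(** An instance of the formulas of Tweedie type: the logarithmic derivative of
    the evidence is the posterior mean of [(a - 1) / s - a / v], so that the
    posterior mean of [v^-1] can be read off the evidence alone. *)
Lemma score_identity (s : R) : 0 < s ->
  (k%:R - 2) / (k%:R * s) - 2 / k%:R * (derive1 evidence s / evidence s) =
  moment gamma (a + 1) (a * s) / moment gamma a (a * s).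
Proof.
move=> s0; rewrite evidence_logderivative//.
have k0 : k%:R != 0 :> R by rewrite pnatr_eq0 -lt0n.
have m0 : moment gamma a (a * s) != 0 by rewrite gt_eqF// moment_gt0// mulr_gt0.
by field; rewrite k0 m0 gt_eqF.
Qed.

End evidence.

(** * The posterior of a single variance *)

(** On the positive reals the inverse is the power with exponent [-1], which is
    measurable. *)
Lemma measurable_inv (R : realType) :
  measurable_fun [set: R] (GRing.inv : R -> R).
Proof.
have -> : (GRing.inv : R -> R) = (fun x : R =>
    if 0 < x then x `^ (-1) else - (- x) `^ (-1)).
  apply/funext => x; case: ltP => x0; first by rewrite powR_inv1// ltW.
  by rewrite powR_inv1 ?oppr_ge0// invrN opprK.
apply: measurable_fun_ifT => //; first exact: measurable_fun_ltr.
by apply: measurableT_comp => //; exact: (measurableT_comp (measurable_powR _)).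
Qed.

Section posterior.
Context (R : realType) (k : nat) (gamma : probability R R).
Local Notation D := (`]0, +oo[%classic : set R).
Local Notation a := (k%:R / 2 : R).

Definition posterior_density (s v : R) : R :=
  likelihood k s v / evidence k gamma s.

Lemma evidence_ge0 s : 0 <= evidence k gamma s.
Proof. by apply: Rintegral_ge0 => v _; exact: likelihood_ge0. Qed.

Lemma integral_likelihood_mkcond (A : set R) s (h : R -> \bar R) :
  (\int[gamma]_(v in A) ((likelihood k s v)%:E * h v) =
   \int[gamma]_(v in A `&` D) ((likelihood k s v)%:E * h v))%E.
Proof.
rewrite [RHS]integral_mkcondr; apply: eq_integral => v _.
rewrite patchE; case: ifPn => //; rewrite notin_setE/= in_itv/= andbT =>
  /negP v0.
by rewrite /likelihood (negbTE v0) mul0e.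
Qed.

Lemma measurable_evidence : measurable_fun [set: R] (evidence k gamma).
Proof.
have -> : evidence k gamma = fine \o
    (fubini_F gamma (fun z : R * R => (likelihood k z.1 z.2)%:E)).
  apply/funext => s; rewrite /evidence /Rintegral /fubini_F /=; congr fine.
  rewrite -[D]setTI; under eq_integral do rewrite -[_%:E]mule1.
  rewrite -(integral_likelihood_mkcond setT s (cst 1%E)).
  by under eq_integral do rewrite mule1.
apply: (measurableT_comp (fine_measurable measurableT)).
apply: measurable_fun_fubini_tonelli_F.
  by apply/measurable_EFinP; exact: measurable_likelihood.
by move=> z; rewrite lee_fin likelihood_ge0.
Qed.

Lemma measurable_posterior_density2 :
  measurable_fun [set: R * R] (fun z => posterior_density z.1 z.2).
Proof.
apply: measurable_funM; first exact: measurable_likelihood.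
apply: (measurableT_comp (@measurable_inv R)).
exact: (measurableT_comp measurable_evidence).
Qed.

Lemma measurable_posterior_density s :
  measurable_fun [set: R] (fun v => (posterior_density s v)%:E).
Proof.
apply/measurable_EFinP.
exact: (measurable_fun_pair2 s measurable_posterior_density2).
Qed.

Lemma posterior_density_ge0 s v : (0 <= (posterior_density s v)%:E)%E.
Proof. by rewrite lee_fin divr_ge0 ?evidence_ge0 ?likelihood_ge0. Qed.

Definition posterior_law (s : R) : {measure set R -> \bar R} :=
  density_measure gamma (measurable_posterior_density s)
    (posterior_density_ge0 s).

Lemma measurable_posterior (A : set R) : measurable A ->
  measurable_fun [set: R] (fun s => posterior_law s A).
Proof.
move=> mA.
pose h (z : R * R) := ((posterior_density z.1 z.2 * \1_A z.2)%:E).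
have mh : measurable_fun [set: R * R] h.
  apply/measurable_EFinP; apply: measurable_funM.
    exact: measurable_posterior_density2.
  exact: measurableT_comp.
have h0 z : (0 <= h z)%E.
  by rewrite /h EFinM mule_ge0 ?posterior_density_ge0 ?lee_fin.
have := measurable_fun_fubini_tonelli_F (m2 := gamma) h mh h0.
congr (measurable_fun _ _); apply/funext => s.
rewrite /fubini_F /posterior_law/= /density_measure [RHS]integral_mkcond.
apply: eq_integral => v _; rewrite /h/= patchE indicE.
by case: ifP => _; rewrite ?mulr1 ?mulr0.
Qed.

Hypothesis k_gt0 : (0 < k)%N.
Hypothesis normalizer_gt0 : 0 < chi2_normalizer R k.
Hypothesis gammaD : (gamma D = 1)%E.

Let a_gt0 : 0 < a. Proof. by rewrite divr_gt0// ltr0n. Qed.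

(** Bayes' formula. For [s <= 0] both sides vanish since the likelihood does. *)
Lemma posterior_bayes (A : set R) s : measurable A ->
  ((evidence k gamma s)%:E * posterior_law s A =
   \int[gamma]_(v in A) (likelihood k s v)%:E)%E.
Proof.
move=> mA; rewrite /posterior_law/= /density_measure -ge0_integralZl;
  last first.
- by rewrite lee_fin evidence_ge0.
- by move=> v _; exact: posterior_density_ge0.
- by apply: measurable_funTS; exact: measurable_posterior_density.
- by [].
apply: eq_integral => v _; rewrite -EFinM /posterior_density.
have [s0|s0] := ltP 0 s; last by rewrite likelihood_le0// mul0r mulr0.
by rewrite mulrCA mulfV ?mulr1// gt_eqF// evidence_gt0.
Qed.

Lemma posterior_setT s : 0 < s -> posterior_law s setT = 1%E.
Proof.
move=> s0; have e0 : 0 < evidence k gamma s by exact: evidence_gt0.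
have := @posterior_bayes setT s measurableT.
under eq_integral do rewrite -[_%:E]mule1.
rewrite (integral_likelihood_mkcond setT s (cst 1%E)) setTI.
under eq_integral do rewrite mule1.
rewrite -[RHS]fineK; last by apply: integrable_fin_num => //;
  exact: integrable_likelihood.
rewrite -/(Rintegral _ _ _) -/(evidence k gamma s).
move/(congr1 (fun x => ((evidence k gamma s)^-1)%:E * x)%E).
by rewrite muleA -!EFinM mulVf ?gt_eqF// mul1e.
Qed.

Lemma posterior_le1 s (A : set R) : measurable A -> (posterior_law s A <= 1)%E.
Proof.
move=> mA; have [s0|s0] := ltP 0 s.
  by rewrite -(posterior_setT s0) le_measure ?inE.
rewrite /posterior_law/= /density_measure integral0_eq// => v _.
by rewrite /posterior_density likelihood_le0// mul0r.
Qed.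

Lemma ge0_integral_posterior s (h : R -> \bar R) : 0 < s ->
  measurable_fun [set: R] h -> (forall v, (0 <= h v)%E) ->
  (\int[posterior_law s]_v h v = \int[gamma]_(v in D)
    ((invgamma_kernel a (a * s) v / moment gamma a (a * s))%:E * h v))%E.
Proof.
move=> s0 mh h0; rewrite integral_density_measure; [|by []|by []|]; last first.
  by move=> v _; exact: h0.
rewrite [RHS]integral_mkcond.
apply: eq_integral => v _; rewrite patchE mem_setE in_itv/= andbT.
rewrite /posterior_density; case: ltP => v0; last first.
  by rewrite /likelihood ltNge v0/= mul0r mul0e.
rewrite likelihoodE// evidenceE// -mulf_div divff ?mul1r//.
by rewrite mulf_neq0 ?gt_eqF ?divr_gt0 ?powR_gt0// ltr0n.
Qed.

Local Notation mean_precision s :=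
  (moment gamma (a + 1) (a * s) / moment gamma a (a * s)).

Lemma mean_precision_gt0 s : 0 < s -> 0 < mean_precision s.
Proof.
move=> s0; have as0 : 0 < a * s by rewrite mulr_gt0.
by rewrite divr_gt0// moment_gt0// addr_gt0.
Qed.

Lemma posterior_ae_gt0 s : {ae posterior_law s, forall v, 0 < v}.
Proof.
exists (~` D); split; first exact: measurableC.
- rewrite /posterior_law/= /density_measure integral0_eq// => v /=.
  rewrite in_itv/= andbT => /negP v0.
  by rewrite /posterior_density /likelihood (negbTE v0) mul0r.
- by move=> v /= v0; rewrite in_itv/= andbT.
Qed.

(** Multiplying a kernel by [v^-1] raises its order by one, so that the
    posterior mean of [v^-1] is a ratio of moments. The absolute value makes the
    integrand nonnegative on the whole line. *)
Lemma integral_abs_inv_posterior s : 0 < s ->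
  (\int[posterior_law s]_v (`|v^-1|)%:E = (mean_precision s)%:E)%E.
Proof.
move=> s0; have as0 : 0 < a * s by rewrite mulr_gt0.
have m0 : 0 < moment gamma a (a * s) by exact: moment_gt0.
rewrite ge0_integral_posterior//; last first.
  apply/measurable_EFinP; apply: (measurableT_comp (@normr_measurable _ _)).
  exact: measurable_inv.
rewrite [in RHS]mulrC EFinM /moment.
have wi : gamma.-integrable D (EFin \o invgamma_kernel (a + 1) (a * s)).
  by apply: integrable_invgamma_kernel => //; rewrite addr_gt0.
rewrite fineK ?integrable_fin_num// -integralZl//.
apply: eq_integral => v; rewrite inE/= in_itv/= andbT => v0.
rewrite -!EFinM invgamma_kernelS// ger0_norm ?invr_ge0 ?ltW//.
by congr _%:E; rewrite [RHS]mulrC (mulrC v^-1) mulrAC.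
Qed.

Lemma integrable_inv_posterior s : 0 < s ->
  (posterior_law s).-integrable setT (EFin \o (GRing.inv : R -> R)).
Proof.
move=> s0; apply/integrableP; split.
  by apply/measurable_EFinP; exact: measurable_inv.
by under eq_integral do rewrite /=; rewrite integral_abs_inv_posterior// ltry.
Qed.

Lemma integrable_ln_posterior s : 0 < s ->
  (posterior_law s).-integrable setT (EFin \o (@ln R)).
Proof.
move=> s0; have as0 : 0 < a * s by rewrite mulr_gt0.
have m0 : 0 < moment gamma a (a * s) by exact: moment_gt0.
apply/integrableP; split; first by apply/measurable_EFinP; exact: measurable_ln.
rewrite ge0_integral_posterior//=; last first.
  apply/measurable_EFinP; apply: (measurableT_comp (@normr_measurable _ _)).
  exact: measurable_ln.
have /integrableP[_] := integrableZl (measurable_itv _)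
  (moment gamma a (a * s))^-1 (integrable_ln_invgamma_kernel gamma a_gt0 as0).
apply: le_lt_trans; rewrite le_eqVlt; apply/orP; left; apply/eqP.
apply: eq_integral => v _ /=.
rewrite normrM (normrM (ln v)) -EFinM [in RHS]ger0_norm ?invr_ge0 ?(ltW m0)//.
rewrite [in RHS](ger0_norm (invgamma_kernel_ge0 _ _ _)).
by congr _%:E; rewrite -mulrA mulrC -mulrA.
Qed.

(** Since [v^-1] and [ln v] are integrable under the posterior, the expected
    loss is finite, and it depends on the estimate [x] through [x * m - ln x],
    where [m] is the posterior mean of [v^-1]. *)
Lemma integral_stein_posterior s x : 0 < s -> 0 < x ->
  let stein v := x / v - ln (x / v) - 1 in
  (posterior_law s).-integrable setT (EFin \o stein) /\
  (\int[posterior_law s]_v (stein v)%:E =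
   (x * mean_precision s - ln x +
    fine (\int[posterior_law s]_v (ln v)%:E)%E - 1)%:E)%E.
Proof.
move=> s0 x0 stein.
have mst : measurable_fun [set: R] stein.
  have mdiv : measurable_fun [set: R] (fun v : R => x / v).
    by apply: measurable_funM => //; exact: measurable_inv.
  apply: measurable_funB => //; apply: measurable_funB => //.
  exact: (measurableT_comp (@measurable_ln R)).
(* [stein] on the positive half-line, written so that linearity of the integral
   applies. *)
pose F v := ((x%:E * (EFin \o (GRing.inv : R -> R)) v + (EFin \o (@ln R)) v) +
             (EFin \o cst (- ln x - 1)%R) v)%E.
have oneP : (posterior_law s setT < +oo)%E by rewrite posterior_setT// ltry.
have icst (c : R) : (posterior_law s).-integrable setT (EFin \o cst c).
  by apply: measurable_bounded_integrable => //; exact: bounded_cst.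
have iinv := integrableZl measurableT x (integrable_inv_posterior s0).
have iln := integrable_ln_posterior s0.
have iF : (posterior_law s).-integrable setT F.
  by apply: integrableD => //; exact: integrableD.
have steinF : ae_eq (posterior_law s) setT F (EFin \o stein).
  apply: filterS (posterior_ae_gt0 s) => v v0 _.
  rewrite /F /stein /= -EFinM -!EFinD lnM ?posrE ?invr_gt0// lnV ?posrE//.
  by congr _%:E; ring.
have mF : measurable_fun setT F by exact: measurable_int iF.
have mst' : measurable_fun setT (EFin \o stein) by exact/measurable_EFinP.
split.
  apply/integrableP; split => //.
  rewrite -(@ae_eq_integral _ _ _ _ _ _ (abse \o F))//; last 3 first.
  - exact: measurableT_comp.
  - exact: measurableT_comp.
  - by apply: filterS steinF => v Fv _; congr abse; exact: Fv.
  by case/integrableP : iF.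
rewrite -(@ae_eq_integral _ _ _ _ _ _ F)//.
rewrite integralD//; last exact: integrableD.
rewrite integralD// integralZl//; last exact: integrable_inv_posterior.
have -> : (\int[posterior_law s]_v (EFin \o cst (- ln x - 1)%R) v =
    (- ln x - 1)%:E)%E.
  transitivity (\int[posterior_law s]_v cst (- ln x - 1)%:E v)%E => //.
  by rewrite integral_cst// posterior_setT// mule1.
have -> : (\int[posterior_law s]_v (EFin \o (GRing.inv : R -> R)) v =
    \int[posterior_law s]_v (`|v^-1|)%:E)%E.
  apply: ae_eq_integral => //.
  - by apply/measurable_EFinP; exact: measurable_inv.
  - apply/measurable_EFinP; apply: (measurableT_comp (@normr_measurable _ _)).
    exact: measurable_inv.
  - apply: filterS (posterior_ae_gt0 s) => v v0 _ /=.
    by rewrite ger0_norm// invr_ge0 ltW.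
rewrite integral_abs_inv_posterior//.
rewrite -[X in (_ + X + _)%E]fineK; last exact: integrable_fin_num.
rewrite -EFinM -!EFinD; congr _%:E; rewrite /=; ring.
Qed.

End posterior.

(** * The prior and the data as probability laws *)

Section weighted_lebesgue.
Local Open Scope ereal_scope.
Context (R : realType) (F : R -> \bar R).
Hypotheses (mF : measurable_fun [set: R] F) (F0 : forall x, 0 <= F x).
Local Notation lambda := (@lebesgue_measure R).

Lemma measurable_id_real :
  measurable_fun [set: measurableTypeR R] (fun x : measurableTypeR R => x : R).
Proof. by move=> _ A mA; rewrite setTI. Qed.

(** The measure with density [F] with respect to the Lebesgue measure, moved to
    the canonical measurable structure of [R] by pushing it forward along the
    identity. *)
Definition weighted_lebesgue : {measure set R -> \bar R} :=
  image_measure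
    (density_measure lambda mF F0) measurable_id_real.

Lemma weighted_lebesgueE A :
  weighted_lebesgue A = \int[lambda]_(x in A) F x.
Proof. by []. Qed.

Lemma integral_weighted_lebesgue (A : set R) (h : R -> \bar R) :
  measurable A -> measurable_fun A h -> (forall x, A x -> 0 <= h x) ->
  \int[weighted_lebesgue]_(x in A) h x = \int[lambda]_(x in A) (F x * h x).
Proof.
move=> mA mh h0.
rewrite (ge0_integral_pushforward measurable_id_real); last 3 first.
- exact: mA.
- exact: mh.
- by move=> x; rewrite inE; exact: h0.
by rewrite integral_density_measure; [|exact: mA|exact: mh|exact: h0].
Qed.

End weighted_lebesgue.

Section prior_law.
Context (R : realType) (g : R -> R).
Local Notation lambda := (@lebesgue_measure R).
Local Notation D := (`]0, +oo[%classic : set R).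

Definition prior_extension (v : R) : \bar R := if 0 < v then (g v)%:E else 0%E.

Lemma measurable_prior_extension :
  prior_density g -> measurable_fun [set: R] prior_extension.
Proof.
move=> [mg _ _].
have -> : prior_extension = (EFin \o g) \_ D.
  apply/funext => v; rewrite patchE mem_setE in_itv/= andbT.
  by rewrite /prior_extension; case: ifP.
by apply/(measurable_restrictT _ (measurable_itv _)); exact/measurable_EFinP.
Qed.

Lemma prior_extension_ge0 :
  prior_density g -> forall v, (0 <= prior_extension v)%E.
Proof.
by move=> [_ g0 _] v; rewrite /prior_extension; case: ifP => // v0;
  rewrite lee_fin g0.
Qed.

Definition prior_law (pg : prior_density g) : set R -> \bar R :=
  weighted_lebesgue (measurable_prior_extension pg) (prior_extension_ge0 pg).

HB.instance Definition _ (pg : prior_density g) := Measure.copy (prior_law pg)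
  (weighted_lebesgue (measurable_prior_extension pg) (prior_extension_ge0 pg)).

Variable pg : prior_density g.

Lemma integral_prior_law (A : set R) (h : R -> \bar R) : measurable A ->
  measurable_fun A h -> (forall v, A v -> 0 <= h v)%E ->
  (\int[prior_law pg]_(v in A) h v =
   \int[lambda]_(v in A `&` D) ((g v)%:E * h v))%E.
Proof.
move=> mA mh h0; rewrite integral_weighted_lebesgue; [|by []|by []|by []].
rewrite [RHS]integral_mkcondr; apply: eq_integral => v _.
rewrite patchE mem_setE in_itv/= andbT /prior_extension.
by case: ifP => //; rewrite mul0e.
Qed.

Lemma prior_lawE (A : set R) : measurable A ->
  (prior_law pg A = \int[lambda]_(v in A `&` D) (g v)%:E)%E.
Proof.
move=> mA; have := @integral_prior_law A (cst 1%E) mA.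
rewrite integral_cst// mul1e => -> //.
by apply: eq_integral => v _; rewrite mule1.
Qed.

Lemma prior_law_gt0 : (prior_law pg D = 1)%E.
Proof. by rewrite prior_lawE// setIid; case: pg. Qed.

Lemma prior_law_setT : (prior_law pg setT = 1)%E.
Proof. by rewrite prior_lawE// setTI; case: pg. Qed.

HB.instance Definition _ :=
  Measure_isProbability.Build _ _ _ (prior_law pg) prior_law_setT.

Lemma prior_law_ae_gt0 : {ae prior_law pg, forall v, 0 < v}.
Proof.
exists (~` D); split; first exact: measurableC.
- by rewrite prior_lawE ?setICl ?integral_set0//; exact: measurableC.
- by move=> v /= v0; rewrite in_itv/= andbT.
Qed.

Lemma marginal_pdfE k s :
  marginal_pdf k g s = evidence k (prior_law pg) s.
Proof.
rewrite /marginal_pdf /evidence /Rintegral; congr fine.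
rewrite integral_prior_law//; last 2 first.
- apply/measurable_EFinP; apply: measurable_funTS.
  exact: (measurable_fun_pair2 s (@measurable_likelihood R k)).
- by move=> v _; rewrite lee_fin likelihood_ge0.
rewrite setIid; apply: eq_integral => v; rewrite inE/= in_itv/= andbT => v0.
by rewrite /likelihood v0 -EFinM mulrC.
Qed.

(** The order of integration over [v] and [s] is exchanged by Tonelli's
    theorem. *)
Lemma integral_sampling_law k (A B : set R) : (0 < k)%N ->
  measurable A -> measurable B ->
  (\int[prior_law pg]_(v in A) sampling_law k v B =
   \int[lambda]_(s in B) \int[prior_law pg]_(v in A) (likelihood k s v)%:E)%E.
Proof.
move=> k_gt0 mA mB.
pose h (z : R * R) := ((\1_A z.1 * \1_B z.2)%:E * (likelihood k z.2 z.1)%:E)%E.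
have mlik : measurable_fun [set: R * R] (fun z => likelihood k z.2 z.1).
  apply: (measurableT_comp (@measurable_likelihood R k)
    (g := fun z : R * R => (z.2, z.1))).
  exact: measurable_fun_pair.
have mh : measurable_fun [set: R * R] h.
  apply: emeasurable_funM; apply/measurable_EFinP => //.
  by apply: measurable_funM; exact: measurableT_comp.
have h0 z : (0 <= h z)%E by rewrite mule_ge0// lee_fin// likelihood_ge0.
have := fubini_tonelli (m1 := prior_law pg) (m2 := lambda) h mh h0.
have -> : (\int[prior_law pg]_v \int[lambda]_s h (v, s) =
    \int[prior_law pg]_(v in A) sampling_law k v B)%E.
  rewrite [RHS]integral_mkcond; apply: ge0_ae_eq_integral => //.
  - exact: (measurable_fun_fubini_tonelli_F (m2 := lambda) h mh h0).
  - apply/(measurable_restrictT _ mA); apply: measurable_funTS.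
    exact: measurable_sampling_law.
  - by move=> v _; exact: integral_ge0.
  - by move=> v _; apply: erestrict_ge0 => ? _; exact: sampling_law_ge0.
  apply: filterS prior_law_ae_gt0 => v v0 _.
  rewrite patchE /h/= indicE; case: ifPn => Av; last first.
    by under eq_integral do rewrite mul0r mul0e; rewrite integral0.
  rewrite sampling_law_density// [RHS]integral_mkcond;
    apply: eq_integral => s _.
  by rewrite mul1r -EFinM patchE indicE; case: ifP; rewrite ?mul1r ?mul0r.
have -> : (\int[lambda]_s \int[prior_law pg]_v h (v, s) =
    \int[lambda]_(s in B) \int[prior_law pg]_(v in A) (likelihood k s v)%:E)%E.
  rewrite [RHS]integral_mkcond; apply: eq_integral => s _.
  rewrite patchE /h/=; case: ifPn => Bs; last first.
    by under eq_integral do rewrite (indicE _ B) (negbTE Bs) mulr0 mul0e;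
      rewrite integral0.
  rewrite [RHS]integral_mkcond; apply: eq_integral => v _.
  by rewrite patchE !indicE Bs mulr1 -EFinM; case: ifP; rewrite ?mul1r ?mul0r.
by [].
Qed.

End prior_law.

Section data_law.
Context (R : realType) (k : nat) (gamma : probability R R).

(** The density of the data, finite by [evidence_extE]. *)
Definition evidence_ext (s : R) : \bar R :=
  (\int[gamma]_v (likelihood k s v)%:E)%E.

Lemma measurable_evidence_ext : measurable_fun [set: R] evidence_ext.
Proof.
pose h (z : R * R) := (likelihood k z.1 z.2)%:E.
apply: (measurable_fun_fubini_tonelli_F (m2 := gamma) h).
  by apply/measurable_EFinP; exact: measurable_likelihood.
by move=> z; rewrite lee_fin likelihood_ge0.
Qed.

Lemma evidence_ext_ge0 s : (0 <= evidence_ext s)%E.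
Proof. by apply: integral_ge0 => v _; rewrite lee_fin likelihood_ge0. Qed.

Definition data_law : {measure set R -> \bar R} :=
  weighted_lebesgue measurable_evidence_ext evidence_ext_ge0.

Local Notation D := (`]0, +oo[%classic : set R).
Hypothesis k_gt0 : (0 < k)%N.
Hypothesis normalizer_gt0 : 0 < chi2_normalizer R k.
Hypothesis gammaD : (gamma D = 1)%E.

Lemma evidence_extE s : evidence_ext s = (evidence k gamma s)%:E.
Proof.
have [s0|s0] := ltP 0 s; last first.
  rewrite /evidence_ext /evidence /Rintegral !integral0_eq// => v _;
    by rewrite likelihood_le0.
rewrite /evidence_ext; under eq_integral do rewrite -[_%:E]mule1.
rewrite (@integral_likelihood_mkcond _ _ _ setT s (cst 1%E)) setTI.
under eq_integral do rewrite mule1.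
by rewrite /evidence /Rintegral fineK// integrable_fin_num//;
  exact: integrable_likelihood.
Qed.

Lemma data_law_ae_gt0 : data_law (~` D) = 0%E.
Proof.
rewrite /data_law weighted_lebesgueE integral0_eq// => s /=.
rewrite in_itv/= andbT => /negP; rewrite -leNgt => s0.
by rewrite /evidence_ext integral0_eq// => v _; rewrite likelihood_le0.
Qed.

(** Disintegration of the joint law of one variance and one observation: the
    evidence in the density of the data cancels the one in Bayes' formula. *)
Lemma integral_posterior_data_law (A B : set R) :
  measurable A -> measurable B ->
  (\int[data_law]_(s in B) posterior_law k gamma s A =
   \int[@lebesgue_measure R]_(s in B)
     \int[gamma]_(v in A) (likelihood k s v)%:E)%E.
Proof.
move=> mA mB; rewrite integral_weighted_lebesgue; last 3 first.
- by [].
- by apply: measurable_funTS; exact: measurable_posterior.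
- by move=> s _; exact: measure_ge0.
by apply: eq_integral => s _; rewrite evidence_extE posterior_bayes.
Qed.

End data_law.

(** * Joint law of the variances and the data *)

Section hierarchical_model.
Context (R : realType) (N k : nat) (g : R -> R) (pg : prior_density g).
Context (d : measure_display) (Omega : measurableType d).
Context (P : probability Omega R) (Sigma2 S2 : {RV P >-> N.-tuple R}).
Hypothesis k_gt0 : (0 < k)%N.
Hypothesis model : hierarchical_model k g Sigma2 S2.

Local Notation lambda := (@lebesgue_measure R).
Local Notation gamma := (prior_law pg).
Local Notation D := (`]0, +oo[%classic : set R).

Lemma measurable_coordinate (X : {RV P >-> N.-tuple R}) (i : 'I_N) :
  measurable_fun [set: Omega] (fun w => tnth (X w) i).
Proof. by apply: (measurableT_comp (measurable_tnth i)). Qed.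

Lemma prior_rectangles (A : 'I_N -> set R) : (forall i, measurable (A i)) ->
  P [set w | forall i, A i (tnth (Sigma2 w) i)] = (\prod_(i < N) gamma (A i))%E.
Proof.
by move=> mA; rewrite model.1//; apply: eq_bigr => i _; rewrite prior_lawE.
Qed.

(** The total mass of the sampling law is the same for all variances, so the
    model can only hold if the chi-square density is not identically zero. *)
Lemma model_normalizer_gt0 : 'I_N -> 0 < chi2_normalizer R k.
Proof.
move=> i; rewrite lt_neqAle chi2_normalizer_ge0 andbT; apply/eqP => /esym C0.
have sl0 v B : sampling_law k v B = 0%E :> \bar R.
  rewrite /sampling_law /chi2_law integral0_eq// => x _.
  by rewrite /chi2_pdf -/(chi2_normalizer R k) C0 invr0 mulr0; case: ifP.
have := model.2 setT (fun=> setT) measurableT (fun=> measurableT).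
rewrite preimage_setT setTI integral0_eq; last first.
  by move=> w _; rewrite (bigD1 i)//= sl0 mul0e.
have -> : [set w | forall i0 : 'I_N, [set: R] (tnth (S2 w) i0)] = setT.
  by apply/seteqP; split.
by rewrite probability_setT => /eqP; rewrite onee_eq0.
Qed.

(** Given the variances, the probability of a rectangle of data is a product of
    sampling laws, and the variances are independent; the expectation of the
    product thus splits, and each factor is an instance of
    [integral_sampling_law]. *)
Lemma joint_rectangles (i : 'I_N) (A : set R) (B : 'I_N -> set R) :
  measurable A -> (forall j, measurable (B j)) ->
  P ([set w | A (tnth (Sigma2 w) i)] `&`
     [set w | forall j, B j (tnth (S2 w) j)]) =
  (\prod_(j < N) \int[lambda]_(s in B j)
     \int[gamma]_(v in (if j == i then A else setT)) (likelihood k s v)%:E)%E.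
Proof.
move=> mA mB.
pose A' := [set t : N.-tuple R | A (tnth t i)].
have mA' : measurable A'.
  by rewrite -[A']setTI; exact: measurable_tnth.
have mA'j j : measurable (if j == i then A else setT) by case: ifP.
rewrite (model.2 A' B mA' mB).
(* The event on the [i]-th variance is absorbed in the [i]-th factor. *)
pose h j v :=
  ((\1_(if j == i then A else setT) v)%:E * sampling_law k v (B j))%E.
have mh j : measurable_fun [set: R] (h j).
  apply: emeasurable_funM; last exact: measurable_sampling_law.
  by apply/measurable_EFinP; exact: measurable_indic.
have h0 j v : (0 <= h j v)%E.
  by rewrite mule_ge0 ?lee_fin// sampling_law_ge0.
transitivity (\int[P]_w \prod_(j < N) h j (tnth (Sigma2 w) j))%E.
  rewrite integral_mkcond; apply: eq_integral => w _; rewrite patchE.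
  case: ifPn => Aw.
    apply: eq_bigr => j _; rewrite /h indicE; case: ifPn => [/eqP ->|_].
      by rewrite mem_set ?mul1e//; move: Aw; rewrite inE.
    by rewrite in_setT mul1e.
  rewrite (bigD1 i)//= /h eqxx indicE memNset ?mul0e//.
  by move: Aw; rewrite notin_setE.
rewrite (integral_prod_indep (mu := fun=> gamma) (measurable_coordinate Sigma2)
  prior_rectangles mh h0).
apply: eq_bigr => j _; rewrite -integral_sampling_law// [RHS]integral_mkcond.
apply: eq_integral => v _; rewrite /h patchE indicE.
by case: (v \in _); rewrite ?mul1e ?mul0e.
Qed.

End hierarchical_model.

(** * Marginals of the regular conditional distribution *)

Section posterior_identification.
Context (R : realType) (N k : nat) (g : R -> R) (pg : prior_density g).
Context (d : measure_display) (Omega : measurableType d).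
Context (P : probability Omega R) (Sigma2 S2 : {RV P >-> N.-tuple R}).
Hypothesis k_gt0 : (0 < k)%N.
Hypothesis model : hierarchical_model k g Sigma2 S2.

Local Notation gamma := (prior_law pg).
Local Notation D := (`]0, +oo[%classic : set R).

Lemma data_rectangles (B : 'I_N -> set R) :
  'I_N -> (forall i, measurable (B i)) ->
  P [set w | forall i, B i (tnth (S2 w) i)] =
  (\prod_(i < N) data_law k gamma (B i))%E.
Proof.
move=> i mB.
rewrite -[X in P X](setTI).
rewrite -[in LHS](preimage_setT (fun w => tnth (Sigma2 w) i)).
rewrite (joint_rectangles pg k_gt0 model i measurableT mB).
by apply: eq_bigr => j _; rewrite if_same.
Qed.

(** The density of the data vanishes on the nonpositive reals. *)
Lemma data_ae_gt0 : {ae P, forall w, forall i, 0 < tnth (S2 w) i}.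
Proof.
apply: filter_forall => i.
pose B j := if j == i then ~` D else setT.
have mB j : measurable (B j).
  by rewrite /B; case: ifP => // _; exact: measurableC.
exists [set w | forall j, B j (tnth (S2 w) j)]; split.
- apply: (measurable_forall_preimage (X := fun i w => tnth (S2 w) i)) => //.
  exact: measurable_coordinate.
- rewrite (data_rectangles i mB) (bigD1 i)//= {1}/B eqxx.
  by rewrite data_law_ae_gt0 mul0e.
- move=> w /= w0 j; rewrite /B; case: ifPn => // /eqP -> /=.
  by rewrite in_itv/= andbT.
Qed.

(** On rectangles of data both sides factor over the coordinates, and the
    factors agree by disintegration; rectangles determine finite measures. *)
Lemma joint_law_posterior (i : 'I_N) (A : set R) (E : set (N.-tuple R)) :
  measurable A -> measurable E ->
  P ([set w | A (tnth (Sigma2 w) i)] `&` S2 @^-1` E) =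
  (\int[P]_(w in S2 @^-1` E) posterior_law k gamma (tnth (S2 w) i) A)%E.
Proof.
move=> mA mE.
have C0 := model_normalizer_gt0 model i.
have mS2 : measurable_fun setT S2 by [].
have mSA : measurable [set w | A (tnth (Sigma2 w) i)].
  by rewrite -[X in measurable X]setTI; exact: measurable_coordinate.
have mpost : measurable_fun [set: Omega] (fun w =>
  posterior_law k gamma (tnth (S2 w) i) A).
  exact: (measurableT_comp (measurable_posterior k gamma mA)
    (measurable_coordinate S2 i)).
have post0 w : (0 <= posterior_law k gamma (tnth (S2 w) i) A)%E by exact:
  measure_ge0.
pose m1 : {measure set (N.-tuple R) -> \bar R} :=
  image_measure
    (mrestr P mSA) mS2.
pose m2 : {measure set (N.-tuple R) -> \bar R} :=
  image_measure
    (density_measure P mpost post0) mS2.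
have m1E F : m1 F = P ([set w | A (tnth (Sigma2 w) i)] `&` S2 @^-1` F).
  by rewrite setIC.
rewrite -m1E -[RHS]/(m2 E).
apply: (tuple_measure_unique (m1 := m1) (m2 := m2)) mE => [|B mB].
  rewrite m1E preimage_setT setIT; apply: le_lt_trans (ltry 1).
  exact: probability_le1.
rewrite m1E (joint_rectangles pg k_gt0 model i mA mB).
rewrite /m2/= /pushforward /density_measure.
pose h j s :=
  ((\1_(B j) s)%:E * (if j == i then posterior_law k gamma s A else 1))%E.
have mh j : measurable_fun [set: R] (h j).
  apply: emeasurable_funM.
    by apply/measurable_EFinP; exact: measurable_indic.
  by case: (j == i) => //; exact: measurable_posterior.
have h0 j s : (0 <= h j s)%E by rewrite mule_ge0 ?lee_fin//; case: ifP.
transitivity (\int[P]_w \prod_(j < N) h j (tnth (S2 w) j))%E; last first.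
  rewrite [RHS]integral_mkcond; apply: eq_integral => w _; rewrite patchE.
  case: ifPn => Bw.
    rewrite (bigD1 i)//= big1 ?mule1.
      rewrite /h eqxx indicE mem_set ?mul1e//.
      by move: Bw; rewrite inE => /(_ i).
    move=> j /negbTE ji; rewrite /h ji mule1 indicE mem_set//.
    by move: Bw; rewrite inE => /(_ j).
  move: Bw; rewrite notin_setE/= => /existsNP[j Bj].
  by rewrite (bigD1 j)//= /h indicE memNset// !mul0e.
rewrite (integral_prod_indep (mu := fun=> data_law k gamma)
  (measurable_coordinate S2) (fun B mB => data_rectangles i mB) mh h0).
apply: eq_bigr => j _; rewrite /h.
transitivity (\int[data_law k gamma]_(s in B j)
   (if j == i then posterior_law k gamma s A else 1))%E; last first.
  rewrite [LHS]integral_mkcond; apply: eq_integral => s _;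
    rewrite patchE indicE.
  by case: (s \in _); rewrite ?mul1e ?mul0e.
have [ji|ji] := eqVneq j i.
  by rewrite integral_posterior_data_law//; exact: prior_law_gt0.
rewrite integral_weighted_lebesgue//; first by apply: eq_integral => s _;
  rewrite mule1.
Qed.


Variable Q : R.-pker N.-tuple R ~> N.-tuple R.
Hypothesis postQ : is_posterior Sigma2 S2 Q.

(** The two functions of the data have the same integral over every event of
    data, by [joint_law_posterior] and the definition of a posterior. *)
Lemma posterior_marginal_ae (i : 'I_N) (A : set R) : measurable A ->
  {ae P, forall w, Q (S2 w) [set t | A (tnth t i)] =
                   posterior_law k gamma (tnth (S2 w) i) A}.
Proof.
move=> mA; have C0 := model_normalizer_gt0 model i.
pose A' := [set t : N.-tuple R | A (tnth t i)].
have mA' : measurable A' by rewrite -[A']setTI; exact: measurable_tnth.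
have mS2 : measurable_fun setT S2 by [].
pose law : {measure set (N.-tuple R) -> \bar R} :=
  image_measure P mS2.
have mQ : measurable_fun setT (fun t => Q t A') by exact: measurable_kernel.
have mpost : measurable_fun [set: N.-tuple R]
    (fun t => posterior_law k gamma (tnth t i) A).
  exact: (measurableT_comp (measurable_posterior k gamma mA) (measurable_tnth
    i)).
have law_fin : (law setT < +oo)%E.
  by rewrite /law/= /pushforward preimage_setT probability_setT ltry.
have Q_post : ae_eq law setT (fun t => posterior_law k gamma (tnth t i) A)
    (fun t => Q t A').
  apply: integral_ae_eq => //.
  - apply/integrableP; split => //.
    apply: (@le_lt_trans _ _ (\int[law]_t cst 1 t)%E).
      apply: ge0_le_integral => //.
      + exact: measurableT_comp.
      + by move=> t _; rewrite gee0_abs// posterior_le1//; exact: prior_law_gt0.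
    by rewrite integral_cst// mul1e.
  - move=> E _ mE.
    rewrite (ge0_integral_pushforward mS2)//; last exact: measurable_funTS.
    rewrite (ge0_integral_pushforward mS2)//; last exact: measurable_funTS.
    by rewrite -[RHS](postQ mA' mE) -[LHS]joint_law_posterior.
have [M [mM M0 QM]] := Q_post.
exists (S2 @^-1` M); split.
- by rewrite -[S2 @^-1` M]setTI; exact: measurable_funP.
- exact: M0.
- by move=> w /= Qw; apply: QM => /= Qw'; apply: Qw; rewrite Qw'.
Qed.

(** Almost surely, the equality holds for the countably many rational rays at
    once, and these determine the marginals. *)
Lemma posterior_marginals_ae : {ae P, forall w, forall i : 'I_N,
  0 < tnth (S2 w) i /\
  forall A, measurable A -> Q (S2 w) [set t | A (tnth t i)] =
                            posterior_law k gamma (tnth (S2 w) i) A}.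
Proof.
have rays : {ae P, forall w, forall n, forall i : 'I_N,
    Q (S2 w) [set t | rational_ray n (tnth t i)] =
    posterior_law k gamma (tnth (S2 w) i) (rational_ray n)}.
  apply: ae_foralln => n; apply: filter_forall => i.
  by apply: posterior_marginal_ae; exact: measurable_rational_ray.
apply: filterS2 data_ae_gt0 rays => w S0 Qray i; split => // A mA.
have C0 := model_normalizer_gt0 model i.
pose m : {measure set R -> \bar R} :=
  image_measure
    (Q (S2 w)) (measurable_tnth i).
apply: (real_measure_unique (m1 := m)) mA.
- by rewrite /m/= /pushforward preimage_setT prob_kernel ltry.
- rewrite /m/= /pushforward preimage_setT prob_kernel posterior_setT//.
  exact: prior_law_gt0.
- by move=> n; exact: Qray.
Qed.

End posterior_identification.

(** * Minimizing the posterior expected loss *)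

Section stein_risk.
Context (R : realType).
Implicit Types m x : R.

(** The inequality [ln y <= y - 1] at [y = x * m]; equality holds for [y = 1]
    only. *)
Lemma stein_risk_min m x : 0 < m -> 0 < x -> 1 + ln m <= x * m - ln x.
Proof.
move=> m0 x0; have xm0 : 0 < x * m by rewrite mulr_gt0.
have lnxm : ln (x * m) <= x * m - 1.
  by rewrite -[X in ln X](subrKC 1) le_ln1Dx// ltrBrDr addNr.
by move: lnxm; rewrite lnM ?posrE//; lra.
Qed.

Lemma stein_risk_argmin m x : 0 < m -> 0 < x ->
  x * m - ln x <= 1 + ln m -> x = m^-1.
Proof.
move=> m0 x0; have xm0 : 0 < x * m by rewrite mulr_gt0.
have [xm1 _|xm1] := eqVneq (x * m) 1.
  by rewrite -[LHS](mulfK (lt0r_neq0 m0)) xm1 mul1r.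
have lnxm : ln (x * m) != 0 by rewrite ln_eq0.
have := expR_gt1Dx lnxm; rewrite lnK ?posrE// lnM ?posrE//; lra.
Qed.

End stein_risk.

Section stein_bayes_risk.
Context (R : realType) (N k : nat) (gamma : probability R R).
Local Notation D := (`]0, +oo[%classic : set R).
Local Notation a := (k%:R / 2 : R).
Hypothesis k_gt0 : (0 < k)%N.
Hypothesis gammaD : (gamma D = 1)%E.
Variables (Q : R.-pker N.-tuple R ~> N.-tuple R) (s : N.-tuple R).
Hypothesis normalizer_gt0 : 'I_N -> 0 < chi2_normalizer R k.
Hypothesis s_gt0 : forall i, 0 < tnth s i.
Hypothesis Q_marginal : forall i A, measurable A ->
  Q s [set t | A (tnth t i)] = posterior_law k gamma (tnth s i) A.

Let m (i : 'I_N) : R :=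
  moment gamma (a + 1) (a * tnth s i) / moment gamma a (a * tnth s i).

Let m_gt0 i : 0 < m i.
Proof. by apply: mean_precision_gt0. Qed.

(** The loss is a sum over the coordinates, so that its expectation depends on
    the marginals only. The constant [c] collects the expectations of [ln v]. *)
Lemma expected_stein_loss : exists c : R, forall x, positive_tuple x ->
  posterior_expected_loss (@stein_loss R N) Q s x =
  (\sum_(i < N) (tnth x i * m i - ln (tnth x i)) + c)%:E.
Proof.
pose l i : R := fine (\int[posterior_law k gamma (tnth s i)]_v (ln v)%:E)%E.
exists (\sum_(i < N) (l i - 1)) => x x0.
rewrite /posterior_expected_loss /stein_loss.
pose h (i : 'I_N) (v : R) := tnth x i / v - ln (tnth x i / v) - 1.
pose law i : {measure set R -> \bar R} :=
  image_measure
    (Q s) (measurable_tnth i).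
have mh i : measurable_fun [set: R] (EFin \o h i).
  have mdiv : measurable_fun [set: R] (fun v : R => tnth x i / v).
    by apply: measurable_funM => //; exact: measurable_inv.
  apply/measurable_EFinP; apply: measurable_funB => //;
    apply: measurable_funB => //.
  exact: (measurableT_comp (@measurable_ln R)).
have lawE i A : measurable A -> A `<=` setT ->
    law i A = posterior_law k gamma (tnth s i) A.
  by move=> mA _; exact: Q_marginal.
have hi i := integral_stein_posterior k_gt0 (normalizer_gt0 i) gammaD
  (s_gt0 i) (x0 i).
have ih i : (Q s).-integrable setT (fun t => (h i (tnth t i))%:E).
  apply/integrableP; split.
    exact: (measurableT_comp (mh i) (measurable_tnth i)).
  have /integrableP[_] := (hi i).1.
  rewrite -(eq_measure_integral _ (lawE i)).
  rewrite (ge0_integral_pushforward (measurable_tnth i))//.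
  have mabs : measurable_fun [set: R] (abse \o (EFin \o h i)).
    exact: measurableT_comp.
  exact: mabs.
under eq_integral do rewrite -sumEFin.
rewrite integral_sum// -big_split/= -sumEFin; apply: eq_bigr => i _.
transitivity (\int[law i]_v (h i v)%:E)%E.
  exact: (esym (integral_pushforward (measurable_tnth i) (mh i) (ih i)
    measurableT)).
rewrite (eq_measure_integral _ (lawE i)) (hi i).2.
by congr _%:E; rewrite /m /l; ring.
Qed.

(** Each coordinate [x_i * m_i - ln x_i] of the expected loss has the unique
    minimizer [x_i = m_i^-1], and the sum is minimal only if all of its terms
    are. *)
Lemma stein_bayes_actionP (x : N.-tuple R) :
  (positive_tuple x /\ forall y, positive_tuple y ->
    (posterior_expected_loss (@stein_loss R N) Q s x <=
     posterior_expected_loss (@stein_loss R N) Q s y)%E) <->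
  forall i, tnth x i = (m i)^-1.
Proof.
have [c lossE] := expected_stein_loss.
split=> [[x0 xmin] i|xE].
  pose y := [tuple (m i)^-1 | i < N].
  have y0 : positive_tuple y by move=> j; rewrite tnth_mktuple invr_gt0.
  have := xmin y y0; rewrite !lossE// lee_fin lerD2r => xy.
  pose F j := tnth x j * m j - ln (tnth x j) - (1 + ln (m j)).
  have F0 j : 0 <= F j by rewrite subr_ge0 stein_risk_min.
  apply: stein_risk_argmin => //; rewrite -subr_le0 -/(F i).
  rewrite (@psumr_eq0P _ _ predT F)//.
  apply/eqP; rewrite eq_le sumr_ge0// andbT sumrB subr_le0.
  apply: (le_trans xy); apply: ler_sum => j _.
  by rewrite tnth_mktuple mulVf ?gt_eqF// lnV ?posrE// opprK.
have x0 : positive_tuple x by move=> i; rewrite xE invr_gt0.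
split=> // y y0; rewrite !lossE// lee_fin lerD2r; apply: ler_sum => i _.
rewrite xE mulVf ?gt_eqF// lnV ?posrE// opprK.
exact: stein_risk_min.
Qed.

End stein_bayes_risk.

Theorem theorem2p2 (R : realType) (N k : nat) (k_gt0 : (0 < k)%N)
    (g : R -> R) (g_prior : prior_density g)
    (d : measure_display) (Omega : measurableType d) (P : probability Omega R)
    (Sigma2 S2 : {RV P >-> N.-tuple R})
    (model : hierarchical_model k g Sigma2 S2)
    (Q : R.-pker N.-tuple R ~> N.-tuple R)
    (posterior : is_posterior Sigma2 S2 Q)
    (delta : N.-tuple R -> N.-tuple R) :
  let f := marginal_pdf k g in
  bayes_rule (@stein_loss R N) S2 Q delta <->
  {ae P, forall w, forall i : 'I_N,
    let s : R := tnth (S2 w) i in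
    tnth (delta (S2 w)) i =
      ((k%:R - 2) / (k%:R * s) - 2 / k%:R * (derive1 f s / f s))^-1}.
Proof.
move=> f; pose gamma := prior_law g_prior.
have gammaD := prior_law_gt0 g_prior.
have C0 := model_normalizer_gt0 model.
have fE : f = evidence k gamma by apply/funext => s; exact: marginal_pdfE.
have marginals := posterior_marginals_ae g_prior k_gt0 model posterior.
have bayesP w : (forall i : 'I_N, 0 < tnth (S2 w) i /\
    forall A, measurable A -> Q (S2 w) [set t | A (tnth t i)] =
                              posterior_law k gamma (tnth (S2 w) i) A) ->
    (positive_tuple (delta (S2 w)) /\
     forall a, positive_tuple a ->
      (posterior_expected_loss (@stein_loss R N) Q (S2 w) (delta (S2 w)) <=
       posterior_expected_loss (@stein_loss R N) Q (S2 w) a)%E) <->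
    forall i : 'I_N, let s : R := tnth (S2 w) i in
      tnth (delta (S2 w)) i =
        ((k%:R - 2) / (k%:R * s) - 2 / k%:R * (derive1 f s / f s))^-1.
  move=> QS.
  apply: (iff_trans (stein_bayes_actionP k_gt0 gammaD C0
    (fun i => (QS i).1) (fun i => (QS i).2) (delta (S2 w)))).
  have scoreE i := score_identity k_gt0 (C0 i) gammaD (QS i).1.
  by split=> dE i /=; rewrite ?fE ?scoreE; have := dE i; rewrite /= ?fE ?scoreE.
split=> [bayes|formula].
  by apply: filterS2 marginals bayes => w /bayesP /[swap] ? [+ _]; apply.
by apply: filterS2 marginals formula => w /bayesP /[swap] ? [_]; apply.
Qed.
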